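(* Let $(\mathfrak g,[\cdot,\cdot]_{\mathfrak g})$ and $(\mathfrak h,[\cdot,\cdot]_{\mathfrak h})$ be Lie algebras and $\rho:\mathfrak g\to\mathrm{Der}(\mathfrak h)$ an action of $\mathfrak g$ on $\mathfrak h$. On $\mathcal C^*(\mathfrak g,\mathfrak h)=\oplus_{k\ge0}\mathrm{Hom}(\wedge^k\mathfrak g,\mathfrak h)$ (with $\mathrm{Hom}(\wedge^k\mathfrak g,\mathfrak h)$ in degree $k$) define, for $f\in\mathrm{Hom}(\wedge^m\mathfrak g,\mathfrak h)$, $$(df)(x_1,\dots,x_{m+1})=\sum_{i=1}^{m+1}(-1)^{m+i}\rho(x_i)f(x_1,\dots,\hat x_i,\dots,x_{m+1})+\sum_{1\le i<j\le m+1}(-1)^{m+i+j-1}f([x_i,x_j]_{\mathfrak g},x_1,\dots,\hat x_i,\dots,\hat x_j,\dots,x_{m+1}),$$ and, for $f_1\in\mathrm{Hom}(\wedge^m\mathfrak g,\mathfrak h)$, $f_2\in\mathrm{Hom}(\wedge^n\mathfrak g,\mathfrak h)$, $$[\![f_1,f_2]\!](x_1,\dots,x_{m+n})=(-1)^{mn+1}\sum_{\sigma\in\mathbb S_{(m,n)}}(-1)^\sigma[f_1(x_{\sigma(1)},\dots,x_{\sigma(m)}),f_2(x_{\sigma(m+1)},\dots,x_{\sigma(m+n)})]_{\mathfrak h}.$$ Then $(\mathcal C^*(\mathfrak g,\mathfrak h),[\![\cdot,\cdot]\!],d)$ is a differential graded Lie algebra. Its Maurer-Cartan elements are precisely the crossed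 homomorphisms from $\mathfrak g$ to $\mathfrak h$ with respect to the action $\rho$.
   Context: All vector spaces are over an algebraically closed field $\mathbb K$ of characteristic $0$. An action of $\mathfrak g$ on $\mathfrak h$ is a Lie algebra homomorphism $\rho:\mathfrak g\to\mathrm{Der}(\mathfrak h)$. A crossed homomorphism with respect to $\rho$ is a linear map $H:\mathfrak g\to\mathfrak h$ with $H[x,y]_{\mathfrak g}=\rho(x)(Hy)-\rho(y)(Hx)+[Hx,Hy]_{\mathfrak h}$ for all $x,y\in\mathfrak g$. $\mathbb S_{(m,n)}$ is the set of $(m,n)$-shuffles, $(-1)^\sigma$ the sign of $\sigma$, and a hat denotes omission. A differential graded Lie algebra is a $\mathbb Z$-graded vector space $L=\oplus_iL_i$ with a bilinear bracket satisfying $[L_i,L_j]\subset L_{i+j}$, $[a,b]=-(-1)^{\bar a\bar b}[b,a]$, $[a,[b,c]]=[[a,b],c]+(-1)^{\bar a\bar b}[b,[a,c]]$ for homogeneous $a,b,c$ ($\bar a$ the degree of $a$), and a linear map $d$ with $d(L_i)\subset L_{i+1}$, $d\circ d=0$, $d[a,b]=[da,b]+(-1)^{\bar a}[a,db]$. A Maurer-Cartan element is a degree $1$ element $\theta\in L_1$ with $d\theta+\frac12[\theta,\theta]=0$. *)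

(* Defs.v *)
From HB Require Import structures.
From mathcomp Require Import all_boot all_order all_algebra.
From mathcomp Require Import fingroup perm zify.
From mathcomp Require Import boolp functions.

Set Implicit Arguments.
Unset Strict Implicit.
Unset Printing Implicit Defensive.

Import GRing.Theory.

Local Open Scope ring_scope.

HB.mixin Record Lmodule_isLie (K : fieldType) L of GRing.Lmodule K L := {
  lie : L -> L -> L;
  lie_linearl : forall y, linear (lie^~ y);
  lie_linearr : forall x, linear (lie x);
  liexx : forall x, lie x x = 0;
  lie_jacobi : forall x y z,
    lie x (lie y z) + lie y (lie z x) + lie z (lie x y) = 0
}.

#[short(type="lieAlgType")]
HB.structure Definition LieAlgebra (K : fieldType) :=
  {L of GRing.Lmodule K L & Lmodule_isLie K L}.

Section LinearFacts.
Variables (K : fieldType) (U V : lmodType K) (f : U -> V).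
Hypothesis linf : linear f.

Lemma linf0 : f 0 = 0.
Proof. by have := linf (-1) 0 0; rewrite !scaleN1r !addNr. Qed.

Lemma linfD : {morph f : x y / x + y}.
Proof. by move=> x y; have := linf 1 x y; rewrite !scale1r. Qed.

Lemma linfZ a : {morph f : x / a *: x}.
Proof. by move=> x; have := linf a x 0; rewrite linf0 !addr0. Qed.

Lemma linfN : {morph f : x / - x}.
Proof. by move=> x; rewrite -scaleN1r linfZ scaleN1r. Qed.

Lemma linfB : {morph f : x y / x - y}.
Proof. by move=> x y; rewrite linfD linfN. Qed.

End LinearFacts.

Section LieFacts.
Variables (K : fieldType) (L : lieAlgType K).
Implicit Types x y z : L.

Lemma lie0r x : lie 0 x = 0. Proof. exact: linf0 (lie_linearl x). Qed.
Lemma lier0 x : lie x 0 = 0. Proof. exact: linf0 (lie_linearr x). Qed.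
Lemma lieDl x y z : lie (x + y) z = lie x z + lie y z.
Proof. exact: linfD (lie_linearl z) _ _. Qed.
Lemma lieDr x y z : lie x (y + z) = lie x y + lie x z.
Proof. exact: linfD (lie_linearr x) _ _. Qed.
Lemma lieC x y : lie x y = - lie y x.
Proof.
have := liexx (x + y); rewrite lieDl !lieDr !liexx add0r addr0.
by move/eqP; rewrite addr_eq0 => /eqP.
Qed.

End LieFacts.

Section Derivations.
Variables (K : fieldType) (h : lieAlgType K).

Definition is_derivation (D : h -> h) : Prop :=
  linear D /\ forall x y, D (lie x y) = lie (D x) y + lie x (D y).

Definition derivation : {pred h -> h} := fun D => `[< is_derivation D >].

Lemma derivation_submod : submod_closed derivation.
Proof.
split=> [|a D E /asboolP[linD derD] /asboolP[linE derE]]; apply/asboolP; split.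
- by move=> b x y; rewrite /= addr0 scaler0.
- by move=> x y; rewrite /= lie0r lier0 addr0.
- move=> b x y; have DE z : (a *: (D : h -> h) + E) z = a *: D z + E z by [].
  by rewrite !DE linD linE !scalerDr !scalerA (mulrC a) addrACA.
- move=> x y; have DE z : (a *: (D : h -> h) + E) z = a *: D z + E z by [].
  rewrite !DE derD derE lieDl lieDr.
  rewrite (linfZ (lie_linearl y)) (linfZ (lie_linearr x)).
  by rewrite scalerDr addrACA.
Qed.

HB.instance Definition _ :=
  GRing.isSubmodClosed.Build K (h -> h) derivation derivation_submod.

Record Der := MkDer { der_fun :> h -> h; _ : der_fun \in derivation }.

HB.instance Definition _ := [isSub for der_fun].
HB.instance Definition _ := [Choice of Der by <:].
HB.instance Definition _ := [SubChoice_isSubLmodule of Der by <:].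

Lemma derP (D : Der) : is_derivation D.
Proof. by case: D => f fD; apply: asboolW. Qed.

Definition der_comm_fun (D E : Der) : h -> h := fun x => D (E x) - E (D x).

Lemma der_comm_subproof D E : der_comm_fun D E \in derivation.
Proof.
have [[linD derD] [linE derE]] := (derP D, derP E).
apply/asboolP; split.
- move=> a x y; rewrite /der_comm_fun linE linD linD linE.
  by rewrite scalerDr scalerN opprD addrACA.
- move=> x y; rewrite /der_comm_fun derE derD !(linfD linD) !(linfD linE).
  rewrite !derD !derE !(linfB (lie_linearl _)) !(linfB (lie_linearr _)).
  set a := lie (D (E x)) y; set b := lie (E x) (D y).
  set c := lie (D x) (E y); set d := lie x (D (E y)).
  set e := lie (E (D x)) y; set i := lie x (E (D y)).
  have -> : a + b + (c + d) = a + d + (b + c).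
    by rewrite [LHS](AC (2*2) ((1*4)*(2*3))).
  have -> : e + c + (b + i) = b + c + (e + i).
    by rewrite [LHS](AC (2*2) ((3*2)*(1*4))).
  by rewrite [b + c]addrC addrKA opprD addrACA.
Qed.

Definition der_comm D E : Der := MkDer (der_comm_subproof D E).

Lemma der_comm_linearl E : linear (der_comm^~ E).
Proof.
move=> a D D'; apply/val_inj/funext => x.
have [linE _] := derP E.
rewrite /= /der_comm_fun /= linE scalerBr opprD addrACA.
by [].
Qed.

Lemma der_comm_linearr D : linear (der_comm D).
Proof.
move=> a E E'; apply/val_inj/funext => x.
have [linD _] := derP D.
rewrite /= /der_comm_fun /= linD scalerBr opprD addrACA.
by [].
Qed.

Lemma der_commxx D : der_comm D D = 0.
Proof. by apply/val_inj/funext => x; rewrite /= /der_comm_fun subrr. Qed.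

Lemma der_comm_jacobi D E F :
  der_comm D (der_comm E F) + der_comm E (der_comm F D)
    + der_comm F (der_comm D E) = 0.
Proof.
apply/val_inj/funext => x /=.
have [[linD _] [linE _] [linF _]] := And3 (derP D) (derP E) (derP F).
transitivity (der_comm_fun D (der_comm E F) x
  + der_comm_fun E (der_comm F D) x + der_comm_fun F (der_comm D E) x) => //.
rewrite /der_comm_fun /= /der_comm_fun.
rewrite (linfB linD) (linfB linE) (linfB linF) !opprB.
set a1 := D (E (F x)); set a2 := D (F (E x)).
set b1 := E (D (F x)); set b2 := E (F (D x)).
set c1 := F (D (E x)); set c2 := F (E (D x)).
rewrite [LHS](AC (2*2*(2*2)*(2*2)) (((1*12)*(7*2))*((3*10)*(5*4))*((11*6)*(9*8)))).
by rewrite /= !subrr !addr0.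
Qed.

HB.instance Definition _ := Lmodule_isLie.Build K Der
  der_comm_linearl der_comm_linearr der_commxx der_comm_jacobi.

End Derivations.

Record lie_hom (K : fieldType) (L M : lieAlgType K) := MkLieHom {
  lie_hom_fun :> L -> M;
  lie_hom_linear : linear lie_hom_fun;
  lie_hom_lie : forall x y,
    lie_hom_fun (lie x y) = lie (lie_hom_fun x) (lie_hom_fun y)
}.

Section Alternating.
Variables (K : fieldType) (g h : lmodType K).

Definition upd k (x : 'I_k -> g) (i : 'I_k) (v : g) : 'I_k -> g :=
  fun j => if j == i then v else x j.

Definition multilinear k (f : ('I_k -> g) -> h) : Prop :=
  forall (x : 'I_k -> g) (i : 'I_k), linear (fun v => f (upd x i v)).

Definition alternating k (f : ('I_k -> g) -> h) : Prop :=
  forall (x : 'I_k -> g) (i j : 'I_k), i != j -> x i = x j -> f x = 0.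

Definition alternating_map k : {pred ('I_k -> g) -> h} :=
  fun f => `[< multilinear f /\ alternating f >].

Lemma alternating_map_submod k : submod_closed (@alternating_map k).
Proof.
split=> [|a f1 f2 /asboolP[mf1 af1] /asboolP[mf2 af2]]; apply/asboolP; split.
- by move=> x i b u v; rewrite /= scaler0 addr0.
- by [].
- have fE x : (a *: (f1 : _ -> h) + f2) x = a *: f1 x + f2 x by [].
  move=> x i b u v; rewrite !fE (mf1 x i) (mf2 x i) !scalerDr !scalerA.
  by rewrite (mulrC a) addrACA.
- have fE x : (a *: (f1 : _ -> h) + f2) x = a *: f1 x + f2 x by [].
  move=> x i j ij xij; rewrite fE (af1 x i j ij xij) (af2 x i j ij xij).
  by rewrite scaler0 addr0.
Qed.

HB.instance Definition _ k := GRing.isSubmodClosed.Build K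
  (('I_k -> g) -> h) (@alternating_map k) (@alternating_map_submod k).

(* Hom(/\^k g, h), presented as alternating k-linear maps on g. *)
Record cochain k := MkCochain {
  cochain_fun :> ('I_k -> g) -> h;
  _ : cochain_fun \in @alternating_map k
}.

HB.instance Definition _ k := [isSub for @cochain_fun k].
HB.instance Definition _ k := [Choice of cochain k by <:].
HB.instance Definition _ k := [SubChoice_isSubLmodule of cochain k by <:].

Lemma cochain_mlin k (f : cochain k) : multilinear f.
Proof. by case: f => f Pf; have [] := asboolW Pf. Qed.

Lemma cochain_alt k (f : cochain k) : alternating f.
Proof. by case: f => f Pf; have [] := asboolW Pf. Qed.

Lemma upd_id k (x : 'I_k -> g) i : upd x i (x i) = x.
Proof. by apply/funext => j; rewrite /upd; case: eqP => [->|]. Qed.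

Lemma updC k (x : 'I_k -> g) i j u v : i != j ->
  upd (upd x i u) j v = upd (upd x j v) i u.
Proof.
move=> ij; apply/funext => l; rewrite /upd; case: (eqVneq l j) => [->|//].
by rewrite eq_sym (negPf ij).
Qed.

Lemma mlin_at0 k (f : ('I_k -> g) -> h) x i :
  multilinear f -> x i = 0 -> f x = 0.
Proof.
move=> mf xi; rewrite -(upd_id x i) xi.
exact: (linf0 (mf x i)).
Qed.

Lemma linear_sum_fun (U V : lmodType K) (I : Type) (r : seq I) (P : pred I)
    (F : I -> U -> V) :
  (forall i, P i -> linear (F i)) ->
  linear (fun v => \sum_(i <- r | P i) F i v).
Proof.
move=> linF a u v; rewrite scaler_sumr -big_split /=.
by apply: eq_bigr => i Pi; rewrite (linF i Pi).
Qed.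

Lemma linear_scale_fun (U V : lmodType K) (b : K) (F : U -> V) :
  linear F -> linear (fun v => b *: F v).
Proof. by move=> linF a u v; rewrite linF scalerDr !scalerA mulrC. Qed.

Lemma linear_add_fun (U V : lmodType K) (F G : U -> V) :
  linear F -> linear G -> linear (fun v => F v + G v).
Proof. by move=> linF linG a u v; rewrite linF linG scalerDr addrACA. Qed.

Lemma alternating_adj k (f : ('I_k -> g) -> h) :
  multilinear f ->
  (forall x (i j : 'I_k), j = i.+1 :> nat -> x i = x j -> f x = 0) ->
  alternating f.
Proof.
move=> mf adj.
have swap x (i j : 'I_k) u v : j = i.+1 :> nat ->
    f (upd (upd x i u) j v) = - f (upd (upd x i v) j u).
  move=> ji; have ij : i != j by apply/eqP => /(congr1 val) /=; lia.
  pose B u v := f (upd (upd x i u) j v).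
  have Br w : linear (B w) by exact: mf.
  have Bl w : linear (B^~ w).
    move=> a u' v'; rewrite /B !(updC _ _ _ ij); exact: mf.
  have Bxx w : B w w = 0.
    apply: (adj _ i j ji); rewrite /upd !eqxx.
    by rewrite (negPf ij).
  have := Bxx (u + v); rewrite (linfD (Bl _)) !(linfD (Br _)) !Bxx add0r addr0.
  by move/eqP; rewrite addr_eq0 => /eqP.
have main d : forall x (i j : 'I_k), j = (i + d.+1)%N :> nat ->
    x i = x j -> f x = 0.
  elim: d => [|d IH] x i j jE xij.
    by apply: (adj x i j) => //; rewrite jE addn1.
  have lt_j' : (i + d.+1 < k)%N by have := ltn_ord j; lia.
  pose j' := Ordinal lt_j'.
  have j'j : j = j'.+1 :> nat by rewrite /= jE addnS.
  have neq : j' != j by apply/eqP => /(congr1 val) /=; lia.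
  have neqi : i != j' by apply/eqP => /(congr1 val) /=; lia.
  have neqij : i != j by apply/eqP => /(congr1 val) /=; lia.
  have -> : x = upd (upd x j' (x j')) j (x j) by rewrite !upd_id.
  rewrite (swap _ _ _ _ _ j'j) (IH _ i j') ?oppr0 //.
  by rewrite /upd (negPf neqij) (negPf neqi) (negPf neq) eqxx.
move=> x i j ij xij; case: (ltngtP i j) => [lt|lt|/val_inj eq].
- by apply: (main (j - i).-1 x i j) => //; lia.
- by apply: (main (i - j).-1 x j i) => //; lia.
- by rewrite eq eqxx in ij.
Qed.

Lemma upd_comp_in m k (x : 'I_k -> g) (s : 'I_m -> 'I_k) (a : 'I_m) p v :
  injective s -> s a = p -> (fun i => upd x p v (s i)) = upd (x \o s) a v.
Proof.
move=> sI <-; apply/funext => i; rewrite /upd /=.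
by rewrite (inj_eq sI).
Qed.

Lemma upd_comp_out m k (x : 'I_k -> g) (s : 'I_m -> 'I_k) p v :
  (forall a, s a != p) -> (fun i => upd x p v (s i)) = x \o s.
Proof. by move=> sp; apply/funext => i; rewrite /upd (negPf (sp i)). Qed.

End Alternating.

Section Bracket.
Variables (K : fieldType) (g : lmodType K) (h : lieAlgType K).

Definition shuffles m n : {set 'S_(m + n)} :=
  [set s : 'S_(m + n) |
    [forall i : 'I_m, forall j : 'I_m,
      (i < j)%N ==> (s (lshift n i) < s (lshift n j))%N] &&
    [forall i : 'I_n, forall j : 'I_n,
      (i < j)%N ==> (s (rshift m i) < s (rshift m j))%N]].

Definition cbracket_fun m n (f1 : cochain g h m) (f2 : cochain g h n)
    (x : 'I_(m + n) -> g) : h :=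
  (-1) ^+ (m * n + 1) *: \sum_(s in shuffles m n)
    (-1) ^+ odd_perm s *: lie (f1 (fun i => x (s (lshift n i))))
                              (f2 (fun j => x (s (rshift m j)))).

Lemma cbracket_mlin m n (f1 : cochain g h m) (f2 : cochain g h n) :
  multilinear (cbracket_fun f1 f2).
Proof.
move=> x p; apply: linear_scale_fun; apply: linear_sum_fun => s _.
apply: linear_scale_fun.
have sL : injective (fun i => s (lshift n i)).
  exact: inj_comp perm_inj (@lshift_inj _ _).
have sR : injective (fun i => s (rshift m i)).
  exact: inj_comp perm_inj (@rshift_inj _ _).
case: (split_ordP ((s^-1)%g p)) => a aE.
- have sa : s (lshift n a) = p by rewrite -aE permKV.
  have -> : (fun v => lie (f1 (fun i => upd x p v (s (lshift n i))))
                          (f2 (fun j => upd x p v (s (rshift m j))))) =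
            (fun v => lie (f1 (upd (x \o (fun i => s (lshift n i))) a v))
                          (f2 (x \o (fun j => s (rshift m j))))).
    apply/funext => v; rewrite (upd_comp_in _ _ sL sa) upd_comp_out // => b.
    by rewrite -sa (inj_eq perm_inj) eq_sym eq_lrshift.
  by move=> c u v; rewrite (cochain_mlin f1 _ _ c) lie_linearl.
- have sa : s (rshift m a) = p by rewrite -aE permKV.
  have -> : (fun v => lie (f1 (fun i => upd x p v (s (lshift n i))))
                          (f2 (fun j => upd x p v (s (rshift m j))))) =
            (fun v => lie (f1 (x \o (fun i => s (lshift n i))))
                          (f2 (upd (x \o (fun j => s (rshift m j))) a v))).
    apply/funext => v; rewrite (upd_comp_in _ _ sR sa) upd_comp_out // => b.
    by rewrite -sa (inj_eq perm_inj) eq_lrshift.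
  by move=> c u v; rewrite (cochain_mlin f2 _ _ c) lie_linearr.
Qed.

Lemma shuffle_tperm m n (s : 'S_(m + n)) (p q : 'I_(m + n)) :
  q = p.+1 :> nat -> ((s^-1)%g p < m)%N != ((s^-1)%g q < m)%N ->
  s \in shuffles m n -> (s * tperm p q)%g \in shuffles m n.
Proof.
move=> qp mix; rewrite !inE => /andP[/forallP sL /forallP sR].
have key (a b : 'I_(m + n)) : (a < m)%N = (b < m)%N -> (s a < s b)%N ->
    ((s * tperm p q)%g a < (s * tperm p q)%g b)%N.
  move=> abm sab; rewrite !permM.
  have nab : ~ (s a = p /\ s b = q).
    by move=> [ap bq]; move: mix; rewrite -ap -bq !permK abm eqxx.
  have neq u : u <> q -> (u <> q :> nat) by move=> uq /val_inj.
  have nep u : u <> p -> (u <> p :> nat) by move=> uq /val_inj.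
  case: tpermP => [ap|aq|/nep ap /neq aq];
    case: tpermP => [bp|bq|/nep bp /neq bq] //; move: sab; 
    rewrite ?ap ?aq ?bp ?bq; try lia.
  by case: nab.
apply/andP; split; apply/forallP => i; apply/forallP => j; apply/implyP => ij.
  by apply: key => /=; [by rewrite !ltn_ord | exact: (implyP (forallP (sL i) j))].
by apply: key => /=; [lia | exact: (implyP (forallP (sR i) j))].
Qed.

Lemma cbracket_alt m n (f1 : cochain g h m) (f2 : cochain g h n) :
  alternating (cbracket_fun f1 f2).
Proof.
apply: alternating_adj (cbracket_mlin f1 f2) _ => x p q qp xpq.
rewrite /cbracket_fun; set F := fun s : 'S_(m + n) =>
  lie (f1 (fun i => x (s (lshift n i)))) (f2 (fun j => x (s (rshift m j)))).
suff -> : \sum_(s in shuffles m n) (-1) ^+ odd_perm s *: F s = 0.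
  by rewrite scaler0.
have pq : p != q by apply/eqP => /(congr1 val) /=; lia.
pose A (s : 'S_(m + n)) := ((s^-1)%g p < m)%N.
pose B (s : 'S_(m + n)) := ((s^-1)%g q < m)%N.
pose t := tperm p q.
have xt a : x (t a) = x a by rewrite /t; case: tpermP => [->|->|].
have At s : A (s * t)%g = B s by rewrite /A /B invMg permM tpermV tpermL.
have Bt s : B (s * t)%g = A s by rewrite /A /B invMg permM tpermV tpermR.
have F0 s : A s = B s -> F s = 0.
  have lE a (am : ((s^-1)%g a < m)%N) : s (lshift n (Ordinal am)) = a.
    by rewrite -[RHS](permKV s); congr (s _); apply/val_inj.
  move=> AB; rewrite /F; have [As|nAs] := boolP (A s).
    have Bs : B s by rewrite -AB.
    rewrite (cochain_alt f1 (i := Ordinal As) (j := Ordinal Bs)) ?lie0r //.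
      by rewrite -val_eqE /= val_eqE (inj_eq perm_inj).
    by rewrite !lE.
  have nBs : ~~ B s by rewrite -AB.
  have spl a : ~~ ((s^-1)%g a < m)%N -> {b | s (rshift m b) = a}.
    move=> nam; case: (split_ordP ((s^-1)%g a)) => b bE.
      by rewrite bE /= ltn_ord in nam.
    by exists b; rewrite -bE permKV.
  have [a sa] := spl p nAs; have [b sb] := spl q nBs.
  rewrite (cochain_alt f2 (i := a) (j := b)) ?lier0 ?sa ?sb //.
  by apply: contraNneq pq => ab; rewrite -sa -sb ab.
have shE s : A s != B s ->
    ((s * t)%g \in shuffles m n) = (s \in shuffles m n).
  move=> mix; apply/idP/idP; last exact: shuffle_tperm.
  move=> st; rewrite -[s]mulg1 -(tperm2 p q) mulgA.
  by apply: shuffle_tperm => //; rewrite -/(A _) -/(B _) At Bt eq_sym.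
rewrite (bigID (fun s => A s && ~~ B s)) /= [X in _ + X](bigID (fun s => B s && ~~ A s)) /=.
rewrite [X in _ + (_ + X)]big1 ?addr0; last first.
  move=> s /andP[/andP[_ n1] n2]; rewrite F0 ?scaler0 //.
  by move: n1 n2; case: (A s); case: (B s).
rewrite [X in _ + X](reindex_inj (mulIg t)) /=.
rewrite [X in _ + X](eq_bigl (fun s => (s \in shuffles m n) && (A s && ~~ B s))); last first.
  move=> s; rewrite At Bt; case As: (A s); case Bs: (B s) => //=; rewrite ?andbF //.
  by rewrite !andbT (shE s) ?As ?Bs.
rewrite -big_split big1 //= => s _.
rewrite odd_permM odd_tperm pq addbT.
have -> : F (s * t)%g = F s.
  by rewrite /F; congr (lie (f1 _) (f2 _)); apply/funext => i; rewrite permM xt.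
by case: (odd_perm s); rewrite ?scaleN1r ?scale1r /= ?expr0 ?expr1 ?scaleN1r ?scale1r ?subrr ?addNr.
Qed.

Lemma cbracket_subproof m n (f1 : cochain g h m) (f2 : cochain g h n) :
  cbracket_fun f1 f2 \in @alternating_map K g h (m + n).
Proof.
by apply/asboolP; split; [exact: cbracket_mlin | exact: cbracket_alt].
Qed.

Definition cbracket m n f1 f2 : cochain g h (m + n) :=
  MkCochain (@cbracket_subproof m n f1 f2).

End Bracket.

Section Differential.
Variables (K : fieldType) (g h : lieAlgType K) (rho : lie_hom g (Der h)).

(* For i < j, the m-tuple (v, x_0, ..., x_m) with x_i and x_j omitted:
   [bump j (bump i l)] is the l-th index of x other than i and j. *)
Definition omit2_args m (x : 'I_m.+1 -> g) (i j : 'I_m.+1) (v : g) :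
    'I_m -> g :=
  fun k => if k == 0 :> nat then v else x (inord (bump j (bump i k.-1))).

(* Indices are 0-based here, hence the successors in the exponents. *)
Definition cdiff_fun m (f : cochain g h m) (x : 'I_m.+1 -> g) : h :=
  \sum_(i < m.+1)
    (-1) ^+ (m + i.+1) *: rho (x i) (f (fun k => x (lift i k))) +
  \sum_(i < m.+1) \sum_(j < m.+1 | (i < j)%N)
    (-1) ^+ (m + i.+1 + j.+1 - 1) *:
      f (omit2_args x i j (lie (x i) (x j))).

Lemma rho_linl w : linear (fun v => rho v w).
Proof. by move=> a u v; rewrite lie_hom_linear. Qed.

Lemma rho_linr v : linear (rho v).
Proof. by have [] := derP (rho v). Qed.

Lemma omit2_idx m (i j : 'I_m.+1) (k : 'I_m) :
  (i < j)%N -> (k != 0 :> nat)%N ->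
  (inord (bump j (bump i k.-1)) : 'I_m.+1) = bump j (bump i k.-1) :> nat.
Proof.
move=> ij k0; rewrite inordK //.
by have := ltn_ord j; have := ltn_ord k; rewrite /bump; lia.
Qed.

Lemma cdiff_mlin m (f : cochain g h m) : multilinear (cdiff_fun f).
Proof.
move=> x p; apply: linear_add_fun.
  apply: linear_sum_fun => i _; apply: linear_scale_fun.
  case: (unliftP i p) => [k pE|pE].
    rewrite (_ : (fun v => _) = (fun v => rho (x i) (f (upd (x \o lift i) k v)))).
      by move=> c u v; rewrite (cochain_mlin f _ _ c) (rho_linr _ c).
    apply/funext => v; rewrite pE.
    have -> : (fun l => upd x (lift i k) v (lift i l)) = upd (x \o lift i) k v.
      exact: upd_comp_in (@lift_inj _ i) erefl.
    by rewrite {1}/upd (negPf (neq_lift _ _)).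
  rewrite (_ : (fun v => _) = (fun v => rho v (f (x \o lift i)))).
    exact: rho_linl.
  apply/funext => v; rewrite -pE (@upd_comp_out _ _ _ _ x (lift p)) => [|a].
    by rewrite /upd eqxx.
  by rewrite pE eq_sym neq_lift.
apply: linear_sum_fun => i _; apply: linear_sum_fun => j ij.
apply: linear_scale_fun.
have m0 : (0 < m)%N by have := ltn_ord j; lia.
pose k0 := Ordinal m0.
have updhead y u v : omit2_args y i j v = upd (omit2_args y i j u) k0 v.
  by apply/funext => k; rewrite /upd /omit2_args -val_eqE /=; case: eqP.
have ne : i != j by apply/eqP => /(congr1 val) /=; lia.
have rest u v : p = i \/ p = j -> omit2_args (upd x p u) i j v = omit2_args x i j v.
  move=> pij; apply/funext => k; rewrite /omit2_args; case: eqP => // /eqP k0'.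
  rewrite /upd; case: eqP => // /(congr1 val) /=; rewrite omit2_idx //.
  by case: pij => ->; rewrite /bump; lia.
case: (eqVneq p i) => [pi|npi].
  rewrite (_ : (fun v => _) =
      (fun v => f (upd (omit2_args x i j 0) k0 (lie v (x j))))).
    by move=> c u v; rewrite lie_linearl (cochain_mlin f _ _ c).
  apply/funext => v; rewrite rest; last by left.
  have -> : upd x p v i = v by rewrite /upd pi eqxx.
  have -> : upd x p v j = x j by rewrite /upd pi eq_sym (negPf ne).
  exact: (congr1 f (updhead _ _ _)).
case: (eqVneq p j) => [pj|npj].
  rewrite (_ : (fun v => _) =
      (fun v => f (upd (omit2_args x i j 0) k0 (lie (x i) v)))).
    by move=> c u v; rewrite lie_linearr (cochain_mlin f _ _ c).
  apply/funext => v; rewrite rest; last by right.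
  have -> : upd x p v j = v by rewrite /upd pj eqxx.
  have -> : upd x p v i = x i by rewrite /upd pj (negPf ne).
  exact: (congr1 f (updhead _ _ _)).
have npi' : (p <> i :> nat) by move=> /val_inj pi; rewrite pi eqxx in npi.
have npj' : (p <> j :> nat) by move=> /val_inj pj; rewrite pj eqxx in npj.
pose kp := (unbump i (unbump j p)).+1.
have ltkp : (kp < m)%N.
  by have := ltn_ord j; have := ltn_ord p; rewrite /kp /unbump; lia.
pose k := Ordinal ltkp.
rewrite (_ : (fun v => _) =
    (fun v => f (upd (omit2_args x i j (lie (x i) (x j))) k v))).
  exact: cochain_mlin.
apply/funext => v; congr (f _); apply/funext => l.
rewrite /omit2_args /upd -(val_eqE l k) /=.
rewrite ![_ == p]eq_sym (negPf npi) (negPf npj).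
have [l0|l0] := eqVneq (l : nat) 0%N; first by rewrite l0.
rewrite -val_eqE /= omit2_idx //.
congr (if _ then _ else _); apply/eqP/eqP; rewrite /kp /bump /unbump; lia.
Qed.

Lemma cdiff_alt m (f : cochain g h m) : alternating (cdiff_fun f).
Proof.
apply: alternating_adj (cdiff_mlin f) _ => x p q qp xpq.
have pq : p != q by apply/eqP => /(congr1 val) /=; lia.
have sameat (a b : 'I_m.+1) : a = b :> nat \/ (a = p :> nat /\ b = q :> nat) \/
    (a = q :> nat /\ b = p :> nat) -> x a = x b.
  by move=> [/val_inj->//|[[/val_inj-> /val_inj->]|[/val_inj-> /val_inj->]]].
have sgn a : ((-1) ^+ a.+1 : K) = - (-1) ^+ a by rewrite exprS mulN1r.
rewrite /cdiff_fun [X in X + _](_ : _ = 0) ?add0r.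
  pose G (i j : 'I_m.+1) := (-1) ^+ (m + i.+1 + j.+1 - 1) *:
      f (omit2_args x i j (lie (x i) (x j))).
  rewrite pair_big_dep /=.
  pose t := tperm p q.
  pose T (u : 'I_m.+1 * 'I_m.+1) := (t u.1, t u.2).
  have TK : involutive T by move=> [i j]; rewrite /T /= !tpermK.
  pose P (u : 'I_m.+1 * 'I_m.+1) :=
    [&& (u.1 < u.2)%N, (u.1 == p) || (u.2 == p) & u != (p, q)].
  pose Q (u : 'I_m.+1 * 'I_m.+1) :=
    [&& (u.1 < u.2)%N, (u.1 == q) || (u.2 == q) & u != (p, q)].
  have nat_ne (a b : 'I_m.+1) : a <> b -> a <> b :> nat by move=> ab /val_inj.
  have QT u : Q (T u) = P u.
    case: u => i j; rewrite /Q /P /T /= !xpair_eqE /t -!val_eqE /=.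
    case: tpermP => [->|->|/nat_ne ip /nat_ne iq];
      case: tpermP => [->|->|/nat_ne jp /nat_ne jq]; rewrite /= ?qp; lia.
  have GT u : P u -> G (T u).1 (T u).2 = - G u.1 u.2.
    have argsE (i j i' j' : 'I_m.+1) v : (i < j)%N -> (i' < j')%N ->
        (forall k : 'I_m, k != 0 :> nat ->
          let a := bump j (bump i k.-1) in let b := bump j' (bump i' k.-1) in
          a = b \/ (a = p :> nat /\ b = q :> nat) \/
            (a = q :> nat /\ b = p :> nat)) ->
        omit2_args x i j v = omit2_args x i' j' v.
      move=> ij ij' H; apply/funext => k; rewrite /omit2_args.
      case: eqP => // /eqP k0; apply: sameat; rewrite !omit2_idx //.
      exact: H.
    case: u => i j /and3P[/= ij /orP[] /eqP E]; rewrite xpair_eqE E /t /= /G.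
      rewrite eqxx /= => jq; rewrite E in ij.
      have qj : (q < j)%N by move: jq; rewrite -val_eqE /=; lia.
      rewrite tpermL tpermD; try by apply/eqP => /(congr1 val) /=; lia.
      rewrite -xpq (argsE q j p j) //; last by move=> k k0 /=; rewrite /bump; lia.
      by rewrite -scaleNr -sgn; congr ((-1) ^+ _ *: _); lia.
    move=> _; rewrite E in ij.
    rewrite tpermL tpermD; try by apply/eqP => /(congr1 val) /=; lia.
    rewrite -xpq (argsE i q i p) //; [|lia|by move=> k k0 /=; rewrite /bump; lia].
    by rewrite -scaleNr -sgn; congr ((-1) ^+ _ *: _); lia.
  have G0 (u : 'I_m.+1 * 'I_m.+1) : (u.1 < u.2)%N -> ~~ P u -> ~~ Q u -> G u.1 u.2 = 0.
    case: u => i j /= ij; rewrite /P /Q /= ij /=.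
    have m0 : (0 < m)%N by have := ltn_ord j; lia.
    have [[-> ->] _ _|npq] := eqVneq (i, j) (p, q).
      rewrite /G xpq liexx (mlin_at0 (i := Ordinal m0) (cochain_mlin f)) ?scaler0 //.
    rewrite !andbT !negb_or -!val_eqE /= => /andP[ip jp] /andP[iq jq].
    pose idx (w : 'I_m.+1) := (unbump i (unbump j w)).+1.
    have idx_lt (w : 'I_m.+1) : w != i :> nat -> w != j :> nat -> (idx w < m)%N.
      by have := ltn_ord j; have := ltn_ord w; rewrite /idx /unbump; lia.
    have lp : (idx p < m)%N by apply: idx_lt; rewrite eq_sym.
    have lq : (idx q < m)%N by apply: idx_lt; rewrite eq_sym.
    rewrite /G (cochain_alt f (i := Ordinal lp) (j := Ordinal lq)) ?scaler0 //.
      by rewrite -val_eqE /= /idx /unbump; lia.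
    have oE w (lw : (idx w < m)%N) v : w != i :> nat -> w != j :> nat ->
        omit2_args x i j v (Ordinal lw) = x w.
      move=> wi wj; rewrite /omit2_args /=; congr (x _); apply: val_inj => /=.
      by rewrite inordK /bump /unbump; have := ltn_ord w; lia.
    by rewrite !oE // eq_sym.
  rewrite (bigID (fun u => P u)) /= [X in _ + X](bigID (fun u => Q u)) /=.
  rewrite [X in _ + (_ + X)]big1 ?addr0 => [|u /andP[/andP[? ?] ?]]; last exact: G0.
  rewrite (eq_bigl P) => [|u]; last by rewrite /P andbA andbb.
  rewrite [X in _ + X](eq_bigl Q) => [|u]; last first.
    rewrite /Q /P; case: u => i j /=; rewrite xpair_eqE -!val_eqE /=; lia.
  rewrite [X in _ + X](reindex_inj (inv_inj TK)) /= (eq_bigl P _ QT).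
  rewrite -big_split big1 // => u Pu.
  transitivity (G u.1 u.2 + G (T u).1 (T u).2) => //.
  by rewrite GT // subrr.
rewrite (bigD1 p) //= (bigD1 q) 1?eq_sym //= big1 ?addr0 => [|i /andP[ip iq]].
  have -> : (fun k => x (lift q k)) = (fun k => x (lift p k)).
    by apply/funext => k; apply: sameat; rewrite /= /bump; lia.
  have -> : ((-1) ^+ (m + q.+1) : K) = - (-1) ^+ (m + p.+1).
    by rewrite -sgn qp -addnS.
  by rewrite -xpq scaleNr subrr.
have [a pa] : exists a, p = lift i a.
  by case: (unliftP i p) ip => [a ->|->]; [exists a | rewrite eqxx].
have [b qb] : exists b, q = lift i b.
  by case: (unliftP i q) iq => [b ->|->]; [exists b | rewrite eqxx].
rewrite (cochain_alt f (i := a) (j := b)) ?(linf0 (rho_linr _)) ?scaler0 -?pa -?qb //.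
by apply: contraNneq pq => ab; rewrite pa qb ab.
Qed.

Lemma cdiff_subproof m (f : cochain g h m) :
  cdiff_fun f \in @alternating_map K g h m.+1.
Proof. by apply/asboolP; split; [exact: cdiff_mlin | exact: cdiff_alt]. Qed.

Definition cdiff m (f : cochain g h m) : cochain g h m.+1 :=
  MkCochain (cdiff_subproof f).

End Differential.

Section DirectSum.
Variables (K : fieldType) (V : nat -> lmodType K).

Record dsum := MkDsum {
  dsum_fun :> forall k, V k;
  dsum_supp : exists N, forall k, (N <= k)%N -> dsum_fun k = 0
}.

Lemma dsumP (F G : dsum) : (forall k, F k = G k) -> F = G.
Proof.
case: F G => F PF [G PG] /= FG.
have {}FG : F = G by apply: functional_extensionality_dep.
by case: _ / FG PG => PG; congr MkDsum; exact: Prop_irrelevance.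
Qed.

HB.instance Definition _ := gen_eqMixin dsum.
HB.instance Definition _ := gen_choiceMixin dsum.

Lemma dsum0_supp : exists N, forall k, (N <= k)%N -> (0 : V k) = 0.
Proof. by exists 0%N. Qed.

Lemma dsumN_supp (F : dsum) :
  exists N, forall k, (N <= k)%N -> - F k = 0.
Proof. by have [N FN] := dsum_supp F; exists N => k /FN->; rewrite oppr0. Qed.

Lemma dsumD_supp (F G : dsum) :
  exists N, forall k, (N <= k)%N -> F k + G k = 0.
Proof.
have [[N FN] [M GM]] := (dsum_supp F, dsum_supp G).
exists (maxn N M) => k; rewrite geq_max => /andP[/FN-> /GM->].
by rewrite addr0.
Qed.

Lemma dsumZ_supp a (F : dsum) :
  exists N, forall k, (N <= k)%N -> a *: F k = 0.
Proof. by have [N FN] := dsum_supp F; exists N => k /FN->; rewrite scaler0. Qed.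

Definition dsum_zero := MkDsum dsum0_supp.
Definition dsum_opp F := MkDsum (dsumN_supp F).
Definition dsum_add F G := MkDsum (dsumD_supp F G).
Definition dsum_scale a F := MkDsum (dsumZ_supp a F).

Lemma dsum_addA : associative dsum_add.
Proof. by move=> F G H; apply: dsumP => k; exact: addrA. Qed.
Lemma dsum_addC : commutative dsum_add.
Proof. by move=> F G; apply: dsumP => k; exact: addrC. Qed.
Lemma dsum_add0 : left_id dsum_zero dsum_add.
Proof. by move=> F; apply: dsumP => k; exact: add0r. Qed.
Lemma dsum_addN : left_inverse dsum_zero dsum_opp dsum_add.
Proof. by move=> F; apply: dsumP => k; exact: addNr. Qed.

HB.instance Definition _ := GRing.isZmodule.Build dsum
  dsum_addA dsum_addC dsum_add0 dsum_addN.

Lemma dsum_scaleA a b F :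
  dsum_scale a (dsum_scale b F) = dsum_scale (a * b) F.
Proof. by apply: dsumP => k; exact: scalerA. Qed.
Lemma dsum_scale1 : left_id 1 dsum_scale.
Proof. by move=> F; apply: dsumP => k; exact: scale1r. Qed.
Lemma dsum_scaleDr : right_distributive dsum_scale +%R.
Proof. by move=> a F G; apply: dsumP => k; exact: scalerDr. Qed.
Lemma dsum_scaleDl F : {morph dsum_scale^~ F : a b / a + b}.
Proof. by move=> a b; apply: dsumP => k; exact: scalerDl. Qed.

HB.instance Definition _ := GRing.Zmodule_isLmodule.Build K dsum
  dsum_scaleA dsum_scale1 dsum_scaleDr dsum_scaleDl.

Lemma dsumDE (F G : dsum) k : (F + G) k = F k + G k. Proof. by []. Qed.
Lemma dsumNE (F : dsum) k : (- F) k = - F k. Proof. by []. Qed.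
Lemma dsumZE a (F : dsum) k : (a *: F) k = a *: F k. Proof. by []. Qed.
Lemma dsum0E k : (0 : dsum) k = 0. Proof. by []. Qed.

Definition dsum_in_fun k (v : V k) (j : nat) : V j :=
  if @eqP _ k j is ReflectT kj then ecast i (V i) kj v else 0.

Lemma dsum_in_supp k (v : V k) :
  exists N, forall j, (N <= j)%N -> dsum_in_fun v j = 0.
Proof.
exists k.+1 => j kj; rewrite /dsum_in_fun; case: eqP => // e.
by rewrite e ltnn in kj.
Qed.

Definition dsum_in k (v : V k) : dsum := MkDsum (dsum_in_supp v).

Lemma dsum_in_same k (v : V k) : dsum_in v k = v.
Proof.
rewrite /= /dsum_in_fun; case: eqP => // e.
by rewrite (eq_irrelevance e erefl).
Qed.

Lemma dsum_in_neq k (v : V k) j : k != j -> dsum_in v j = 0.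
Proof. by move=> kj; rewrite /= /dsum_in_fun; case: eqP kj => // ->; rewrite eqxx. Qed.

(* The summands in degrees k >= 0; the degree i part is 0 for i < 0. *)
Definition dsum_degree (i : int) (F : dsum) : Prop :=
  forall k : nat, k%:Z != i -> F k = 0.

End DirectSum.

Section DGLA.
Variables (K : fieldType) (L : lmodType K).

(* L is the internal direct sum of the subspaces L_i, i in Z. *)
Record is_grading (gr : int -> L -> Prop) : Prop := IsGrading {
  grading0 : forall i, gr i 0;
  grading_linear : forall i a x y, gr i x -> gr i y -> gr i (a *: x + y);
  grading_span : forall x, exists (s : seq int) (c : int -> L),
    (forall i, gr i (c i)) /\ x = \sum_(i <- s) c i;
  grading_free : forall (s : seq int) (c : int -> L),
    uniq s -> (forall i, gr i (c i)) -> \sum_(i <- s) c i = 0 ->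
    forall i, i \in s -> c i = 0
}.

Record is_dgla (gr : int -> L -> Prop) (br : L -> L -> L) (d : L -> L) : Prop :=
  IsDGLA {
  dgla_grading : is_grading gr;
  dgla_bilinearl : forall y, linear (br^~ y);
  dgla_bilinearr : forall x, linear (br x);
  dgla_degree : forall i j x y, gr i x -> gr j y -> gr (i + j) (br x y);
  dgla_antisym : forall i j x y, gr i x -> gr j y ->
    br x y = - ((-1) ^ (i * j) *: br y x);
  dgla_jacobi : forall i j k x y z, gr i x -> gr j y -> gr k z ->
    br x (br y z) = br (br x y) z + (-1) ^ (i * j) *: br y (br x z);
  dgla_dlinear : linear d;
  dgla_ddegree : forall i x, gr i x -> gr (i + 1) (d x);
  dgla_dd : forall x, d (d x) = 0;
  dgla_dbr : forall i x y, gr i x ->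
    d (br x y) = br (d x) y + (-1) ^ i *: br x (d y)
}.

Definition maurer_cartan (gr : int -> L -> Prop) (br : L -> L -> L)
    (d : L -> L) (theta : L) : Prop :=
  gr 1 theta /\ d theta + 2^-1 *: br theta theta = 0.

End DGLA.

Section Complex.
Variables (K : fieldType) (g h : lieAlgType K).

Definition complex := dsum (fun k => cochain g h k : lmodType K).

(* The (m, k - m) component of the bracket has type
   [cochain (m + (k - m))], whence the cast. *)
Definition complex_br_fun (F G : complex) (k : nat) : cochain g h k :=
  \sum_(m < k.+1)
    ecast i (cochain g h i) (subnKC (leq_ord m)) (cbracket (F m) (G (k - m)%N)).

Lemma cbracket0l m n (f : cochain g h n) : cbracket (0 : cochain g h m) f = 0.
Proof.
apply/val_inj/funext => x; rewrite /= /cbracket_fun big1 ?scaler0 // => s _.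
by rewrite lie0r scaler0.
Qed.

Lemma cbracket0r m n (f : cochain g h m) : cbracket f (0 : cochain g h n) = 0.
Proof.
apply/val_inj/funext => x; rewrite /= /cbracket_fun big1 ?scaler0 // => s _.
by rewrite lier0 scaler0.
Qed.

Lemma ecast_cochain0 m n (e : m = n) : ecast i (cochain g h i) e 0 = 0.
Proof. by case: _ / e. Qed.

Lemma complex_br_supp (F G : complex) :
  exists N, forall k, (N <= k)%N -> complex_br_fun F G k = 0.
Proof.
have [[N FN] [M GM]] := (dsum_supp F, dsum_supp G).
exists (N + M)%N => k NMk; apply: big1 => m _.
have [/FN->|mN] := leqP N m; first by rewrite cbracket0l ecast_cochain0.
rewrite GM ?cbracket0r ?ecast_cochain0 //; lia.
Qed.

Definition complex_br (F G : complex) : complex :=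
  MkDsum (complex_br_supp F G).

Lemma complex_br_in m n (f1 : cochain g h m) (f2 : cochain g h n) :
  complex_br (dsum_in f1) (dsum_in f2) = dsum_in (cbracket f1 f2).
Proof.
pose D k f : complex := @dsum_in K (fun k => cochain g h k : lmodType K) k f.
have term m' p k (e : (m' + p)%N = k) :
    ecast i (cochain g h i) e (cbracket (D m f1 m') (D n f2 p)) =
    if (m == m') && (n == p) then D (m + n)%N (cbracket f1 f2) k else 0.
  case: _ / e; have [<-|mm] := eqVneq m m'; last first.
    by rewrite /D (dsum_in_neq _ mm) cbracket0l.
  have [<-|np] := eqVneq n p; last by rewrite /D (dsum_in_neq _ np) cbracket0r.
  by rewrite /D !dsum_in_same.
apply: dsumP => k.
transitivity (complex_br_fun (D m f1) (D n f2) k) => //; rewrite /complex_br_fun.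
under eq_bigr do rewrite (term _ _ _ (subnKC _)).
rewrite -big_mkcond; have [mnk|mnk] := eqVneq (m + n)%N k; last first.
  by rewrite /D (dsum_in_neq _ mnk) big1.
have mk : (m < k.+1)%N by lia.
rewrite (big_pred1 (Ordinal mk)) // => i.
by rewrite /= -val_eqE /= eq_sym; case: eqP => //= ->; lia.
Qed.

Definition complex_degree : int -> complex -> Prop :=
  @dsum_degree K (fun k => cochain g h k : lmodType K).

Variable rho : lie_hom g (Der h).

Definition complex_diff_fun (F : complex) (k : nat) : cochain g h k :=
  if k is k'.+1 then cdiff rho (F k') else 0.

Lemma cdiff0 m : cdiff rho (0 : cochain g h m) = 0.
Proof.
apply/val_inj/funext => x; rewrite /= /cdiff_fun !big1 ?addr0 //.
  by move=> i _; rewrite big1 // => j _; rewrite scaler0.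
by move=> i _; rewrite (linf0 (rho_linr _ _)) scaler0.
Qed.

Lemma complex_diff_supp (F : complex) :
  exists N, forall k, (N <= k)%N -> complex_diff_fun F k = 0.
Proof.
have [N FN] := dsum_supp F; exists N.+1 => -[|k] //= Nk.
by rewrite FN ?cdiff0.
Qed.

Definition complex_diff (F : complex) : complex :=
  MkDsum (complex_diff_supp F).

Lemma complex_diff_in m (f : cochain g h m) :
  complex_diff (dsum_in f) = dsum_in (cdiff rho f).
Proof.
pose D k f : complex := @dsum_in K (fun k => cochain g h k : lmodType K) k f.
apply: dsumP => -[|k]; first by rewrite (dsum_in_neq _ (_ : m.+1 != 0%N)).
transitivity (cdiff rho (D m f k)) => //.
have [<-|mk] := eqVneq m k; first by rewrite /D !dsum_in_same.
by rewrite /D (dsum_in_neq _ mk) cdiff0 (@dsum_in_neq K _ m.+1 _ k.+1).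
Qed.

Definition crossed_hom (H : {linear g -> h}) : Prop :=
  forall x y, H (lie x y) = rho x (H y) - rho y (H x) + lie (H x) (H y).

Definition cochain1_fun (H : {linear g -> h}) (x : 'I_1 -> g) : h := H (x ord0).

Lemma cochain1_subproof H : cochain1_fun H \in @alternating_map K g h 1.
Proof.
apply/asboolP; split=> [x i a u v|x i j]; last by rewrite !ord1 eqxx.
by rewrite /cochain1_fun /upd !ord1 eqxx linearP.
Qed.

Definition cochain1 H : cochain g h 1 := MkCochain (cochain1_subproof H).

Lemma cochain1_inj H H' : cochain1 H = cochain1 H' -> H =1 H'.
Proof. by move=> /(congr1 val) /= HH x; apply: (congr1 (@^~ (fun=> x)) HH). Qed.

Lemma cochain1_surj (f : cochain g h 1) : exists H, f = cochain1 H.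
Proof.
have linH : linear (fun v => f (fun=> v)).
  have updE v : (fun=> v) = upd (fun=> 0) (ord0 : 'I_1) v :> ('I_1 -> g).
    by apply/funext => i; rewrite /upd ord1 eqxx.
  by move=> a u v; rewrite (updE (_ + v)) (updE u) (updE v) (cochain_mlin f).
pose H : {linear g -> h} :=
  HB.pack (fun v => f (fun=> v)) (GRing.isLinear.Build _ _ _ _ _ linH).
exists H; apply/val_inj/funext => x; rewrite /= /cochain1_fun /=.
by congr (f _); apply/funext => i; rewrite ord1.
Qed.

End Complex.

Arguments complex {K} g h.
Arguments complex_degree {K} g h i _.
Arguments complex_br {K} g h F G.

(* Main.v *)
Require Import Defs.
From mathcomp Require Import all_boot all_order all_algebra.
From mathcomp Require Import fingroup perm zify.
From mathcomp Require Import boolp functions.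

Set Implicit Arguments.
Unset Strict Implicit.
Unset Printing Implicit Defensive.

Import GRing.Theory.
Local Open Scope ring_scope.

(** A cochain is turned into a function on lists of elements of [g], so that the
    contraction [contr v] by [v : g] becomes [f |-> fun s => f (v :: s)] and casts
    between degrees disappear. Up to signs depending only on the degrees, the
    bracket is the exterior product [wedge] induced by the bracket of [h], and
    the differential is the Chevalley-Eilenberg one, [ce]. The Cartan relations
      [contr v (f1 /\ f2) = contr v f1 /\ f2 + (-1)^|f1| f1 /\ contr v f2],
      [contr v (ce f) = lied v f - ce (contr v f)],
      [contr w (lied v f) = lied v (contr w f) - contr [v, w] f]
    determine these operations recursively, and every identity of the DGLA
    follows by induction on the number of arguments. On [H : g -> h], the
    Maurer-Cartan expression evaluated at [x, y] is
    [rho x (H y) - rho y (H x) + [H x, H y] - H [x, y]]. *)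

(** * The exterior product on functions of lists: graded antisymmetry and graded Jacobi identity *)

Section ListCochains.
Variables (K : fieldType) (g h : lieAlgType K).
Implicit Types (f : seq g -> h) (v w : g) (s : seq g).

Definition contr v f : seq g -> h := fun s => f (v :: s).

(** The degree involution. The degree is read off the argument, so that [f] need not be
    homogeneous. *)
Definition sgn f : seq g -> h := fun s => (-1) ^+ size s *: f s.

(** The Leibniz rule for contraction is taken as the definition, with [sgn f1] carrying the sign
    (-1)^|f1|. *)
Fixpoint wedge f1 f2 s : h :=
  if s is v :: s' then wedge (contr v f1) f2 s' + wedge (sgn f1) (contr v f2) s'
  else lie (f1 [::]) (f2 [::]).

Lemma contr_sgn v f : contr v (sgn f) = - sgn (contr v f).
Proof. by apply/funext => s; rewrite /contr /sgn /= exprS mulN1r scaleNr. Qed.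

Lemma sgnK : involutive sgn.
Proof.
by move=> f; apply/funext => s; rewrite /sgn scalerA -exprMn mulrNN mulr1 expr1n scale1r.
Qed.

Lemma sgn_linear : linear sgn.
Proof.
move=> a f f'; apply/funext => s; rewrite /sgn.
have E (u w : seq g -> h) : (a *: u + w) s = a *: u s + w s by [].
by rewrite !E scalerDr !scalerA mulrC.
Qed.

Lemma wedge_linearl f2 : linear (wedge^~ f2).
Proof.
move=> a f f'; apply/funext => s.
have E t (u w : seq g -> h) : (a *: u + w) t = a *: u t + w t by [].
rewrite E; elim: s f f' f2 => [|v s IHs] f f' f2 /=; first exact: lie_linearl.
by rewrite sgn_linear !IHs scalerDr addrACA.
Qed.

Lemma wedge_linearr f1 : linear (wedge f1).
Proof.
move=> a f f'; apply/funext => s.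
have E t (u w : seq g -> h) : (a *: u + w) t = a *: u t + w t by [].
rewrite E; elim: s f f' f1 => [|v s IHs] f f' f1 /=; first exact: lie_linearr.
by rewrite !IHs scalerDr addrACA.
Qed.

Lemma contr_wedge v f1 f2 :
  contr v (wedge f1 f2) = wedge (contr v f1) f2 + wedge (sgn f1) (contr v f2).
Proof. by []. Qed.

Lemma sgn_wedge f1 f2 : sgn (wedge f1 f2) = wedge (sgn f1) (sgn f2).
Proof.
apply/funext => s; elim: s f1 f2 => [|v s IHs] f1 f2.
  by rewrite /sgn /= !expr0 !scale1r.
rewrite -[LHS]/(contr v (sgn (wedge f1 f2)) s) -[RHS]/(contr v (wedge _ _) s).
rewrite contr_sgn !contr_wedge !contr_sgn (linfD sgn_linear).
rewrite (linfN (wedge_linearl _)) (linfN (wedge_linearr _)) -opprD.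
have E (u w : seq g -> h) : (- (u + w)) s = - (u s + w s) by [].
by rewrite !E !IHs.
Qed.

(** The signs depend on parities only, and contraction flips a parity with no special case in degree
    0. *)
Definition has_parity (p : bool) f := forall s, odd (size s) != p -> f s = 0.

Lemma parity_sgn p f : has_parity p f -> sgn f = (-1) ^+ p *: f.
Proof.
move=> fp; apply/funext => s; rewrite /sgn -[RHS]/((-1) ^+ p *: f s) -signr_odd.
by have [->//|/fp->] := eqVneq (odd (size s)) p; rewrite !scaler0.
Qed.

Lemma parity_contr p f v : has_parity p f -> has_parity (~~ p) (contr v f).
Proof. by move=> fp s sp; apply: fp; rewrite /= eqb_negLR. Qed.

(** Exchanging the factors exchanges the two terms of the Leibniz rule, so induction applies to
    each. At the empty list both sides vanish if both factors are odd, and otherwise antisymmetry in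
    [h] remains. *)
Lemma wedgeC p q f1 f2 : has_parity p f1 -> has_parity q f2 ->
  wedge f1 f2 = - ((-1) ^+ (p && q) *: wedge f2 f1).
Proof.
move=> fp fq; apply/funext => s.
have E t (a : K) (u : seq g -> h) : (- (a *: u)) t = - (a *: u t) by [].
rewrite E; elim: s p q f1 f2 fp fq => [|v s IHs] p q f1 f2 fp fq.
  have [/= pq|npq] := boolP (p && q); last by rewrite expr0 scale1r /= lieC.
  by case/andP: pq fp fq => -> -> fp fq; rewrite fp // fq // !lie0r scaler0 oppr0.
rewrite -!/(contr v (wedge _ _) s) !contr_wedge !(parity_sgn fp, parity_sgn fq).
rewrite (linfZ (wedge_linearl _)) [in RHS](linfZ (wedge_linearl _)).
have D (a : K) (u w : seq g -> h) : (u + a *: w) s = u s + a *: w s by [].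
have [vp vq] := (parity_contr v fp, parity_contr v fq).
rewrite !D (IHs _ _ _ _ vp fq) (IHs _ _ _ _ fp vq) scalerDr opprD scalerA addrC.
by congr (_ + _); case: p q {fp fq vp vq} => -[];
  rewrite /= ?expr0 ?expr1 ?scaleN1r ?scale1r ?mulN1r ?mul1r ?opprK ?scale1r ?scaleN1r ?opprK.
Qed.

Lemma parity_wedge p q f1 f2 : has_parity p f1 -> has_parity q f2 ->
  has_parity (p (+) q) (wedge f1 f2).
Proof.
move=> fp fq s; elim: s p q f1 f2 fp fq => [|v s IHs] p q f1 f2 fp fq /= spq.
  case: p fp spq => [fp _|fp]; first by rewrite fp // lie0r.
  by case: q fq => // fq _; rewrite fq // lier0.
rewrite (parity_sgn fp) (linfZ (wedge_linearl _)).
have D (a : K) (u : seq g -> h) : (a *: u) s = a *: u s by [].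
rewrite D (IHs _ _ _ _ (parity_contr v fp) fq) ?(IHs _ _ _ _ fp (parity_contr v fq)).
- by rewrite scaler0 addr0.
- by case: (odd _) p q spq {fp fq} => -[] [].
- by case: (odd _) p q spq {fp fq} => -[] [].
Qed.

Lemma contr_wedge_parity p v f1 f2 : has_parity p f1 ->
  contr v (wedge f1 f2) =
  wedge (contr v f1) f2 + (-1) ^+ p *: wedge f1 (contr v f2).
Proof. by move=> fp; rewrite contr_wedge (parity_sgn fp) (linfZ (wedge_linearl _)). Qed.

(** Contraction yields, up to sign, one instance of the identity for each of the three factors. At
    the empty list everything vanishes if [f1] and [f2] are odd; otherwise the claim is the Jacobi
    identity of [h]. *)
Lemma wedge_jacobi p q f1 f2 f3 : has_parity p f1 -> has_parity q f2 ->
  wedge f1 (wedge f2 f3) =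
  wedge (wedge f1 f2) f3 + (-1) ^+ (p && q) *: wedge f2 (wedge f1 f3).
Proof.
move=> fp fq; apply/funext => s.
have E t (a : K) (u w : seq g -> h) : (u + a *: w) t = u t + a *: w t by [].
have Z t (a : K) (u : seq g -> h) : (a *: u) t = a *: u t by [].
have D t (u w : seq g -> h) : (u + w) t = u t + w t by [].
rewrite E; elim: s p q f1 f2 f3 fp fq => [|v s IHs] p q f1 f2 f3 fp fq.
  have -> : wedge f2 (wedge f1 f3) [::] = lie (f2 [::]) (lie (f1 [::]) (f3 [::])) by [].
  have [/= pq|npq] := boolP (p && q).
    case/andP: pq fp fq => -> -> fp fq.
    by rewrite fp // fq // !lie0r scaler0 addr0.
  rewrite /= expr0 scale1r; set a := f1 [::]; set b := f2 [::]; set c := f3 [::].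
  have /eqP := lie_jacobi a b c.
  rewrite -addrA addr_eq0 opprD => /eqP ->; rewrite addrC; congr (_ + _).
    by rewrite lieC opprK.
  by rewrite [lie c a]lieC (linfN (lie_linearr _)) opprK.
have [vp vq] := (parity_contr v fp, parity_contr v fq).
rewrite -!/(contr v (wedge _ _) s).
rewrite (contr_wedge_parity _ _ fp) (contr_wedge_parity _ _ fq).
rewrite (contr_wedge_parity _ _ (parity_wedge fp fq)) (contr_wedge_parity _ _ fp).
rewrite (contr_wedge_parity _ _ fq) (contr_wedge_parity _ _ fp).
rewrite !(linfD (wedge_linearl _)) !(linfD (wedge_linearr _)).
rewrite !(linfZ (wedge_linearl _)) !(linfZ (wedge_linearr _)) !(E, D, Z).
rewrite (IHs _ _ _ _ _ vp fq) (IHs _ _ _ _ _ fp vq) (IHs _ _ _ _ _ fp fq).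
move: (wedge (wedge (contr v f1) f2) f3 s) => a1.
move: (wedge f2 (wedge (contr v f1) f3) s) => a2.
move: (wedge (wedge f1 (contr v f2)) f3 s) => a3.
move: (wedge (contr v f2) (wedge f1 f3) s) => a4.
move: (wedge (wedge f1 f2) (contr v f3) s) => a5.
move: (wedge f2 (wedge f1 (contr v f3)) s) => a6.
rewrite !scalerDr !scalerA.
(* [a1], [a3], [a5] come from [wedge (wedge f1 f2) f3], and [a4], [a2], [a6] from
   [wedge f2 (wedge f1 f3)], in the order of the factors contracted. *)
rewrite [LHS](AC (2*(2*2)) ((1*3*5)*(4*(2*6)))); congr (_ + _ + _).
  by case: p q {fp fq vp vq} => -[]; rewrite /= ?mulN1r ?mul1r ?expr0 ?expr1 ?opprK.
by case: p q {fp fq vp vq} => -[];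
  rewrite /= ?expr0 ?expr1 ?mulN1r ?mul1r ?opprK.
Qed.

End ListCochains.

(** * Lie derivative, Chevalley-Eilenberg differential and the Cartan relations *)

Section CartanCalculus.
Variables (K : fieldType) (g h : lieAlgType K) (rho : lie_hom g (Der h)).
Implicit Types (f : seq g -> h) (v w : g) (s : seq g).

(** The Lie derivative: unfolded, it is [rho v] of the value minus the sum of the values with one
    entry [w] replaced by [lie v w]. *)
Fixpoint lied v f s : h :=
  if s is w :: s' then lied v (contr w f) s' - f (lie v w :: s')
  else rho v (f [::]).

(** Cartan's formula read as a recursion. The value at the empty list is 0 because the differential
    raises degrees. *)
Fixpoint ce f s : h :=
  if s is v :: s' then lied v f s' - ce (contr v f) s' else 0.

Lemma contr_lied v w f :
  contr w (lied v f) = lied v (contr w f) - contr (lie v w) f.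
Proof. by []. Qed.

Lemma contr_ce v f : contr v (ce f) = lied v f - ce (contr v f).
Proof. by []. Qed.

Lemma lied_linear v : linear (lied v).
Proof.
move=> a f f'; apply/funext => s.
have E t (u w : seq g -> h) : (a *: u + w) t = a *: u t + w t by [].
rewrite E; elim: s f f' => [|w s IHs] f f' /=; first exact: rho_linr.
have -> : contr w (a *: f + f') = a *: contr w f + contr w f' by [].
by rewrite IHs E scalerBr opprD addrACA.
Qed.

Lemma ce_linear : linear ce.
Proof.
move=> a f f'; apply/funext => s.
have E t (u w : seq g -> h) : (a *: u + w) t = a *: u t + w t by [].
rewrite E; elim: s f f' => [|w s IHs] f f' /=; first by rewrite addr0 scaler0.
have -> : contr w (a *: f + f') = a *: contr w f + contr w f' by [].
by rewrite IHs lied_linear E scalerBr opprD addrACA.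
Qed.

Lemma sgn_lied v f : sgn (lied v f) = lied v (sgn f).
Proof.
apply/funext => s; elim: s f => [|w s IHs] f; first by rewrite /sgn /= !scale1r.
have B (u u' : seq g -> h) : (u - u') s = u s - u' s by [].
have N (u : seq g -> h) : (- u) s = - u s by [].
rewrite -[LHS]/(contr w (sgn _) s) -[RHS]/(contr w (lied _ _) s).
rewrite contr_lied !contr_sgn contr_lied (linfN (lied_linear _)).
by rewrite (linfB (@sgn_linear _ _ _)) !(B, N) IHs opprB opprK addrC.
Qed.

Lemma sgn_ce f : sgn (ce f) = - ce (sgn f).
Proof.
apply/funext => s; elim: s f => [|v s IHs] f.
  by rewrite -[RHS]/(- 0) oppr0 /sgn /= scaler0.
have B (u u' : seq g -> h) : (u - u') s = u s - u' s by [].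
have N (u : seq g -> h) : (- u) s = - u s by [].
rewrite -[LHS]/(contr v (sgn _) s) -[RHS]/(- (contr v (ce _) s)).
rewrite contr_ce !contr_sgn contr_ce (linfN ce_linear).
by rewrite (linfB (@sgn_linear _ _ _)) sgn_lied !(B, N) IHs.
Qed.

(** The base case is that [rho v] is a derivation of [h]; contraction then reproduces the claim on
    shorter lists. *)
Lemma lied_wedge v f1 f2 :
  lied v (wedge f1 f2) = wedge (lied v f1) f2 + wedge f1 (lied v f2).
Proof.
apply/funext => s; elim: s f1 f2 => [|w s IHs] f1 f2.
  by have [_ derv] := derP (rho v); exact: derv.
have D (u u' : seq g -> h) : (u + u') s = u s + u' s by [].
have N (u : seq g -> h) : (- u) s = - u s by [].
rewrite -[LHS]/(contr w (lied _ _) s).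
rewrite -[RHS]/((contr w (wedge _ _) + contr w (wedge _ _)) s).
rewrite contr_lied !contr_wedge !contr_lied (linfD (lied_linear _)) sgn_lied.
rewrite (linfB (wedge_linearl _)) (linfB (wedge_linearr _)).
rewrite !(D, N) !IHs opprD.
by rewrite [LHS](AC (2*2*2) (((1*5)*3)*(2*(4*6)))).
Qed.

(** Contraction reduces the claim to [lied_wedge] and two instances of itself on a shorter list. Six
    terms on each side then match, with [sgn_ce] supplying the signs. *)
Lemma ce_wedge f1 f2 :
  ce (wedge f1 f2) = wedge (ce f1) f2 + wedge (sgn f1) (ce f2).
Proof.
apply/funext => s; elim: s f1 f2 => [|v s IHs] f1 f2.
  by rewrite -[RHS]/(lie 0 _ + lie _ 0) lie0r lier0 addr0.
have D (u u' : seq g -> h) : (u + u') s = u s + u' s by [].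
have N (u : seq g -> h) : (- u) s = - u s by [].
rewrite -[LHS]/(contr v (ce _) s).
rewrite -[RHS]/((contr v (wedge _ _) + contr v (wedge _ _)) s).
rewrite contr_ce !contr_wedge !contr_ce (linfD ce_linear) lied_wedge.
rewrite (linfB (wedge_linearl _)) (linfB (wedge_linearr _)) sgn_ce contr_sgn.
rewrite !(linfN (wedge_linearl _)) !(D, N) !IHs !(D, N) !sgnK !opprD.
by rewrite [LHS](AC (2*(2*2)) (((1*3)*5)*(4*(2*6)))).
Qed.

Definition list_mlin f := forall t s, linear (fun v => f (t ++ v :: s)).

Lemma list_mlin_contr f v : list_mlin f -> list_mlin (contr v f).
Proof. by move=> lf t s; exact: lf (v :: t) s. Qed.

(** At the empty list, [rho] is a Lie homomorphism. After contraction by [u], the double brackets in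
    the first slot combine by the Jacobi identity of [g], and linearity of [f] splits the resulting
    difference. *)
Lemma lied_comm v w f : list_mlin f ->
  lied v (lied w f) - lied w (lied v f) = lied (lie v w) f.
Proof.
move=> lf; apply/funext => s; elim: s f lf => [|u s IHs] f lf.
  by rewrite -[LHS]/(rho v _ - rho w _) /= lie_hom_lie.
have D (a a' : seq g -> h) : (a + a') s = a s + a' s by [].
have N (a : seq g -> h) : (- a) s = - a s by [].
rewrite -[LHS]/((contr u (lied _ _) - contr u (lied _ _)) s).
rewrite -[RHS]/(contr u (lied _ _) s) !contr_lied.
rewrite !(linfB (lied_linear _)) !(D, N) -(IHs _ (list_mlin_contr u lf)).
rewrite !(D, N).
have -> : lie (lie v w) u = lie v (lie w u) - lie w (lie v u).
  have /eqP := lie_jacobi v w u; rewrite -addrA addr_eq0 => /eqP ->.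
  rewrite [lie u v]lieC (linfN (lie_linearr _)) opprD opprK addrC addKr.
  exact: lieC.
have -> : contr (lie v (lie w u) - lie w (lie v u)) f s =
   contr (lie v (lie w u)) f s - contr (lie w (lie v u)) f s by exact: linfB (lf [::] s) _ _.
rewrite ?opprB ?opprD ?opprK.
rewrite [LHS](AC (2*2*(2*2)) (((1*8)*(3*6))*((5*2)*(7*4)))).
by rewrite /= !subrr !addr0.
Qed.

(** Once both sides are contracted by [w] and induction is applied, their difference is
    [lied_comm]. *)
Lemma lied_ce v f : list_mlin f -> lied v (ce f) = ce (lied v f).
Proof.
move=> lf; apply/funext => s; elim: s f lf => [|w s IHs] f lf.
  by rewrite /= (linf0 (rho_linr _ _)).
have D (a a' : seq g -> h) : (a + a') s = a s + a' s by [].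
have N (a : seq g -> h) : (- a) s = - a s by [].
rewrite -[LHS]/(contr w (lied _ _) s) -[RHS]/(contr w (ce _) s).
rewrite contr_lied !contr_ce contr_lied (linfB ce_linear) (linfB (lied_linear _)).
rewrite -(lied_comm _ _ lf) !(D, N) (IHs _ (list_mlin_contr w lf)) !opprB.
by rewrite [LHS](AC (2*(1*2)) ((1*5)*(4*(3*2)))) /= subrr add0r.
Qed.

(** Two uses of Cartan's formula give [lied v (ce f) - ce (lied v f) + ce (ce (contr v f))]. The
    first two terms cancel by [lied_ce], the last vanishes by induction. *)
Lemma ce_ce f : list_mlin f -> ce (ce f) = 0.
Proof.
move=> lf; apply/funext => s; elim: s f lf => // v s IHs f lf.
rewrite -[LHS]/(contr v (ce _) s) !contr_ce (linfB ce_linear) (lied_ce _ lf).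
rewrite opprB addrC subrK.
exact: IHs (list_mlin_contr v lf).
Qed.

End CartanCalculus.

(** * The exterior product as a signed sum over shuffles *)

Lemma reindex_lift_perm0 (V : nmodType) n (P : pred 'S_n.+1) (F : 'S_n.+1 -> V) :
  \sum_(s | P s) F s =
  \sum_(k < n.+1) \sum_(s : 'S_n | P (lift_perm k ord0 s)) F (lift_perm k ord0 s).
Proof.
(* [lp (k, s)] takes the value [ord0] at [k] and follows [s] elsewhere, so [k] and [s] can be
   recovered; counting then gives bijectivity. *)
pose lp (u : 'I_n.+1 * 'S_n) := lift_perm u.1 ord0 u.2.
have lpI : injective lp.
  move=> [k s] [l t] /= E; have kl : k = l.
    apply: (@perm_inj _ (lp (k, s))); rewrite {2}E /lp /= !lift_perm_id //.
  congr (_, _) => //; apply/permP => i; apply: (@lift_inj _ ord0).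
  by rewrite -(lift_perm_lift k) -(lift_perm_lift l) -/(lp (k, s)) E /lp kl.
rewrite (reindex lp); first by rewrite pair_big_dep.
apply: onW_bij; apply: inj_card_bij => //.
by rewrite card_prod card_ord !card_Sn factS.
Qed.

Section ShuffleSum.
Variables (K : fieldType) (g h : lieAlgType K).
Implicit Types (f : seq g -> h) (v : g) (s : seq g).

Definition has_degree n f := forall s, size s != n -> f s = 0.

Lemma contr_degree n f v : has_degree n.+1 f -> has_degree n (contr v f).
Proof. by move=> fn s sn; apply: fn. Qed.

Lemma contr_degree0 f v : has_degree 0 f -> contr v f = 0.
Proof. by move=> f0; apply/funext => s; apply: f0. Qed.

Lemma sgn_degree n f : has_degree n f -> sgn f = (-1) ^+ n *: f.
Proof.
move=> fn; apply/funext => s; rewrite /sgn -[RHS]/((-1) ^+ n *: f s).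
by have [->//|/fn->] := eqVneq (size s) n; rewrite !scaler0.
Qed.

Lemma degree_parity n f : has_degree n f -> has_parity (odd n) f.
Proof. by move=> fn s sn; apply: fn; apply: contraNneq sn => ->. Qed.

Lemma wedge_degree m n f1 f2 : has_degree m f1 -> has_degree n f2 ->
  has_degree (m + n)%N (wedge f1 f2).
Proof.
move=> f1m f2n s; elim: s m n f1 f2 f1m f2n => [|v s IHs] m n f1 f2 f1m f2n smn /=.
  case: m f1m smn => [_ |m f1m _]; last by rewrite f1m // lie0r.
  by case: n f2n => // n f2n _; rewrite f2n // lier0.
rewrite (sgn_degree f1m) (linfZ (wedge_linearl _)).
rewrite -[X in _ + X]/((-1) ^+ m *: wedge f1 (contr v f2) s).
have -> : wedge (contr v f1) f2 s = 0.
  case: m f1m smn => [|m] f1m smn.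
    by rewrite contr_degree0 // (linf0 (wedge_linearl f2)).
  exact: IHs (contr_degree v f1m) f2n smn.
case: n f2n smn => [|n] f2n smn.
  by rewrite (contr_degree0 v f2n) (linf0 (wedge_linearr f1)) scaler0 addr0.
rewrite addnS eqSS in smn.
by rewrite (IHs _ _ _ _ f1m (contr_degree v f2n) smn) scaler0 addr0.
Qed.

(** In [wedge f1 f2 s] the left factor only sees sublists of [s]. This disposes of a left factor
    whose degree exceeds the length of [s]. *)
Lemma wedge_eq0l f1 f2 s :
  (forall t, (size t <= size s)%N -> f1 t = 0) -> wedge f1 f2 s = 0.
Proof.
elim: s f1 f2 => [|v s IHs] f1 f2 f10 /=; first by rewrite f10 // lie0r.
rewrite !IHs ?addr0 // => t ts; last exact: f10.
by rewrite /sgn f10 ?scaler0 // leqW.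
Qed.

(* The [(m, N - m)]-shuffles, as permutations of ['I_N] rather than of
   ['I_(m + n)]: the recursion on [N] then needs no cast. *)
Definition block_shuffles N m : {set 'S_N} :=
  [set s : 'S_N | [forall i : 'I_N, forall j : 'I_N,
     [&& (i < j)%N & (j < m)%N || (m <= i)%N] ==> (s i < s j)%N]].

Lemma block_shufflesP N m (s : 'S_N) :
  reflect (forall i j : 'I_N, (i < j)%N -> (j < m)%N || (m <= i)%N -> (s i < s j)%N)
    (s \in block_shuffles N m).
Proof.
rewrite inE; apply: (iffP forallP) => [H i j ij mij|H i].
  by apply: (implyP (forallP (H i) j)); rewrite ij.
by apply/forallP => j; apply/implyP => /andP[ij mij]; apply: H.
Qed.

Lemma shuffles_block m n : shuffles m n = block_shuffles (m + n)%N m.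
Proof.
apply/setP => s; apply/idP/block_shufflesP.
  rewrite inE => /andP[/forallP sL /forallP sR] i j ij mij.
  case: (split_ordP i) => a ia; case: (split_ordP j) => b jb; subst i j.
  - exact: (implyP (forallP (sL a) b)).
  - by move: mij; rewrite /=; have := ltn_ord a; lia.
  - by move: ij; rewrite /=; have := ltn_ord b; lia.
  - by apply: (implyP (forallP (sR a) b)); move: ij; rewrite /= ltn_add2l.
move=> H; rewrite inE; apply/andP; split; apply/forallP => i; apply/forallP => j;
  apply/implyP => ij; apply: H => //=; first by rewrite ltn_ord.
- by rewrite ltn_add2l.
- by rewrite leq_addr orbT.
Qed.

(** A shuffle takes its least value at the head of a block, that is at [m] or at 0; deleting this
    entry shortens that block. The condition [0 < m] avoids counting the same position twice when
    the first block is empty. *)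
Lemma lift_perm_block N m (k : 'I_N.+1) (s : 'S_N) :
  (lift_perm k ord0 s \in block_shuffles N.+1 m) =
  ((k == m :> nat) && (s \in block_shuffles N m)) ||
  [&& k == 0 :> nat, (0 < m)%N & s \in block_shuffles N m.-1].
Proof.
have val i : (lift_perm k ord0 s (lift k i)) = (s i).+1 :> nat.
  by rewrite lift_perm_lift.
have val0 : (lift_perm k ord0 s k) = 0 :> nat by rewrite lift_perm_id.
apply/block_shufflesP/idP => [H|].
  (* Otherwise the head of the block of [k] precedes [k] and would need a value below 0. *)
  have km : (k == m :> nat) || (k == 0 :> nat) && (0 < m)%N.
    apply: contraT => nkm.
    have [lt_km|le_mk] := ltnP k m.
      have := H ord0 k; rewrite val0 ltn0 => F.
      by apply: F; [|rewrite lt_km]; move: nkm lt_km; case: (k : nat) => //=; lia.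
    have mN : (m < N.+1)%N by apply: leq_ltn_trans le_mk (ltn_ord k).
    by have := H (Ordinal mN) k; rewrite val0 ltn0 => F; apply: F => /=;
      move: nkm le_mk; lia.
  case/orP: km => [/eqP km|/andP[/eqP k0 m0]].
    rewrite km eqxx /=; apply/orP; left; apply/block_shufflesP => i j ij mij.
    by rewrite -ltnS -!val; apply: H; rewrite /= /bump; lia.
  rewrite k0 m0 /=; apply/orP; right; apply/block_shufflesP => i j ij mij.
  by rewrite -ltnS -!val; apply: H; rewrite /= /bump; lia.
have main m' (sm : s \in block_shuffles N m') (km : (k = m :> nat /\ m' = m) \/
   (k = 0 :> nat /\ 0 < m /\ m' = m.-1)%N) :
   forall i j : 'I_N.+1, (i < j)%N -> (j < m)%N || (m <= i)%N ->
     (lift_perm k ord0 s i < lift_perm k ord0 s j)%N.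
  move/block_shufflesP: sm => sm i j.
  case: (unliftP k i) => [i' ->|->]; case: (unliftP k j) => [j' ->|->].
  - rewrite !val ltnS => ij mij.
    by apply: sm; move: ij mij km; rewrite /= /bump; lia.
  - by rewrite /= /bump; lia.
  - by rewrite val val0.
  - by rewrite ltnn.
case/orP => [/andP[/eqP km sm]|/and3P[/eqP k0 m0 sm]].
  by apply: (main m) => //; left.
by apply: (main m.-1) => //; right.
Qed.

Lemma map_lift_perm N (k : 'I_N.+1) (s : 'S_N) v (x : seq g) :
  [seq (v :: x)`_(lift_perm k ord0 s i) | i <- enum 'I_N.+1] =
  take k [seq x`_(s i) | i <- enum 'I_N] ++ v :: drop k [seq x`_(s i) | i <- enum 'I_N].
Proof.
set L := [seq _ | _ <- enum 'I_N].
have sL : size L = N by rewrite size_map size_enum_ord.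
have kN : (k <= N)%N by rewrite -ltnS.
apply: (@eq_from_nth _ 0) => [|i].
  by rewrite size_cat /= size_takel ?sL // size_drop size_map size_enum_ord sL; lia.
rewrite size_map size_enum_ord => iN.
rewrite (nth_map ord0) ?size_enum_ord // nth_cat size_takel ?sL //.
have -> : nth ord0 (enum 'I_N.+1) i = Ordinal iN by apply/val_inj; rewrite /= nth_enum_ord.
have LE (j : 'I_N) : L`_j = x`_(s j).
  by rewrite (nth_map j) ?size_enum_ord ?nth_ord_enum.
case: (unliftP k (Ordinal iN)) => [j ij|ik].
  have iE : i = bump k j by have := congr1 val ij.
  rewrite ij lift_perm_lift /= iE /bump.
  case: (leqP k j) => kj /=; rewrite ?add0n ?add1n.
    by rewrite ltnNge leqW //= subSn // /= nth_drop subnKC.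
  by rewrite kj nth_take.
have iE : i = k by have := congr1 val ik.
by rewrite ik lift_perm_id /= iE ltnn subnn.
Qed.

Definition shuffle_sum N m f1 f2 s : h :=
  \sum_(t in block_shuffles N m) (-1) ^+ odd_perm t *:
    lie (f1 (take m [seq s`_(t i) | i <- enum 'I_N]))
        (f2 (drop m [seq s`_(t i) | i <- enum 'I_N])).

(** Splitting the shuffles by the slot that receives the head [v] reproduces the recursion of
    [wedge]: slot 0 feeds [v] to [f1], slot [m] feeds it to [f2], at the cost (-1)^m of passing the
    [m] arguments of [f1]. *)
Lemma shuffle_sum_wedge N m f1 f2 s : size s = N -> (m <= N)%N ->
  has_degree m f1 -> shuffle_sum N m f1 f2 s = wedge f1 f2 s.
Proof.
move=> <- {N}; elim: s m f1 f2 => [|v s IHs] m f1 f2 mN f1m.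
  have -> : m = 0%N by move: mN; rewrite leqn0 => /eqP.
  rewrite /shuffle_sum (big_pred1 1%g) => [|t /=].
    by rewrite odd_perm1 expr0 scale1r enum_ord0.
  rewrite [RHS](_ : _ = true); last by apply/eqP/permP => -[].
  by apply/block_shufflesP => -[].
rewrite /shuffle_sum reindex_lift_perm0.
under eq_bigr do under eq_bigl do rewrite lift_perm_block.
set N := size s in mN IHs *.
pose L (t : 'S_N) := [seq s`_(t i) | i <- enum 'I_N].
have sL t : size (L t) = N by rewrite size_map size_enum_ord.
pose T (k : 'I_N.+1) (t : 'S_N) : h :=
  (-1) ^+ odd_perm (lift_perm k ord0 t) *:
    lie (f1 (take m [seq (v :: s)`_(lift_perm k ord0 t i) | i <- enum 'I_N.+1]))
        (f2 (drop m [seq (v :: s)`_(lift_perm k ord0 t i) | i <- enum 'I_N.+1])).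
have Tm (k : 'I_N.+1) t : k = m :> nat -> T k t = (-1) ^+ m *: ((-1) ^+ odd_perm t *:
    lie (f1 (take m (L t))) (contr v f2 (drop m (L t)))).
  move=> km; have mN' : (m <= N)%N by rewrite -km -ltnS.
  rewrite /T map_lift_perm odd_lift_perm addbF signr_addb signr_odd -scalerA km.
  have s1 : size (take m (L t)) = m by rewrite size_takel ?sL.
  by rewrite -/(L t) take_size_cat // drop_size_cat.
have T0 (k : 'I_N.+1) m' t : m = m'.+1 -> k = 0 :> nat -> T k t = (-1) ^+ odd_perm t *:
    lie (contr v f1 (take m' (L t))) (f2 (drop m' (L t))).
  move=> mE k0; rewrite /T map_lift_perm odd_lift_perm k0 take0 drop0 mE.
  by rewrite addbF.
change (\sum_(k < N.+1) \sum_(t : 'S_N |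
  ((k == m :> nat) && (t \in block_shuffles N m)) ||
  [&& k == 0 :> nat, (0 < m)%N & t \in block_shuffles N m.-1]) T k t =
  wedge (contr v f1) f2 s + wedge (sgn f1) (contr v f2) s).
rewrite (sgn_degree f1m) (linfZ (wedge_linearl _)).
rewrite -[X in _ = _ + X]/((-1) ^+ m *: wedge f1 (contr v f2) s).
rewrite big_ord_recl; case: m => [|m] in mN f1m T Tm T0 *.
  (* With an empty first block the two slots coincide; correspondingly [contr v f1] is 0. *)
  rewrite (contr_degree0 v f1m) (linf0 (wedge_linearl _)) -[X in _ = X + _]/(0 : h).
  rewrite add0r [X in _ + X]big1 ?addr0 => [|k _]; last by rewrite big_pred0.
  rewrite -(IHs 0%N) // /shuffle_sum scaler_sumr; apply: eq_big => t.
    by rewrite eqxx andbF orbF.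
  by move=> _; rewrite Tm.
congr (_ + _).
  rewrite -(IHs m) //; last exact: contr_degree.
  by apply: eq_bigr => t _; rewrite (T0 _ m).
(* In the second case the second block is empty: no slot is left for [v] there, and [s] is too short
   for [f1]. *)
have [mN'|Nm] := ltnP m N; last first.
  rewrite big1 => [|k _]; last first.
    by rewrite big_pred0 // => t; rewrite /= /bump /= add1n eqSS ltn_eqF // (leq_trans _ Nm).
  by rewrite wedge_eq0l ?scaler0 // => t ts; rewrite f1m // neq_ltn ltnS (leq_trans ts).
rewrite (bigD1 (Ordinal mN')) //= [X in _ + X]big1 => [|k km]; last first.
  rewrite big_pred0 // => t; rewrite /= /bump /= add1n eqSS.
  by rewrite -val_eqE /= in km; rewrite (negPf km).
rewrite addr0 -(IHs m.+1) // /shuffle_sum scaler_sumr; apply: eq_big => t.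
  by rewrite /bump /= add1n eqxx /= orbF.
by move=> _; rewrite Tm.
Qed.

End ShuffleSum.

(** * The closed formula for the Chevalley-Eilenberg differential *)

Section OmitFormula.
Variables (K : fieldType) (g h : lieAlgType K) (rho : lie_hom g (Der h)).
Implicit Types (f : seq g -> h) (v w : g) (s : seq g).

Definition list_alt f := forall t v w s, f (t ++ v :: w :: s) = - f (t ++ w :: v :: s).

Lemma list_alt_contr f v : list_alt f -> list_alt (contr v f).
Proof. by move=> fa t; exact: fa (v :: t). Qed.

Definition omit i s := take i s ++ drop i.+1 s.

Lemma omit0 v s : omit 0 (v :: s) = s.
Proof. exact: drop0. Qed.

Lemma size_omit i s : (i < size s)%N -> size (omit i s) = (size s).-1.
Proof. by move=> si; rewrite size_cat size_take size_drop si; lia. Qed.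

Lemma nth_omit i s k : (omit i s)`_k = s`_(bump i k).
Proof.
elim: i s k => [|i IHi] [|v s] k; rewrite /omit ?nth_nil //=.
  by rewrite drop0.
case: k => [|k] //=; rewrite -/(omit i s) IHi /bump ltnS.
by rewrite !addnS.
Qed.

(** Indices start at 0 and the overall degree sign is left out. As [i < j], omitting [j] first
    leaves position [i] unchanged. *)
Definition ce_diff f s : h :=
  \sum_(i < size s) (-1) ^+ i *: rho s`_i (f (omit i s)) +
  \sum_(i < size s) \sum_(j < size s | (i < j)%N) (-1) ^+ (i + j) *:
    f (lie s`_i s`_j :: omit i (omit j s)).

(** Alternation moves the bracket from slot [j] to the front at the cost (-1)^j. *)
Lemma lied_omit v f s : list_alt f ->
  lied rho v f s = rho v (f s) -
    \sum_(j < size s) (-1) ^+ j *: f (lie v s`_j :: omit j s).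
Proof.
elim: s f => [|w s IHs] f fa; first by rewrite big_ord0 subr0.
rewrite big_ord_recl /= expr0 scale1r omit0 IHs; last first.
  exact: list_alt_contr.
rewrite -addrA; congr (_ + _); rewrite addrC opprD; congr (_ - _).
apply: eq_bigr => j _; rewrite /bump /= add1n exprS mulN1r scaleNr -scalerN.
congr (_ *: _); exact: (fa [::]).
Qed.

(** The terms with [i = 0] come from [lied v f], the others from [ce (contr v f)]. There the minus
    sign of Cartan's formula offsets the exchange of [v] with the bracket in front. *)
Lemma ce_explicit f s : list_alt f -> ce rho f s = ce_diff f s.
Proof.
elim: s f => [|v s IHs] f fa; first by rewrite /ce_diff !big_ord0 addr0.
rewrite /= (lied_omit _ _ fa) (IHs _ (list_alt_contr v fa)) /ce_diff /=.
rewrite !big_ord_recl /= expr0 scale1r omit0.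
rewrite -!addrA; congr (_ + _); rewrite opprD addrCA; congr (_ + _).
  rewrite -sumrN; apply: eq_bigr => i _.
  by rewrite /bump /= add1n exprS mulN1r scaleNr.
congr (_ + _).
  rewrite [in RHS]big_mkcond big_ord_recl /= add0r -sumrN; apply: eq_bigr => j _.
  rewrite /bump /= add1n exprS mulN1r scaleNr.
  by rewrite omit0.
rewrite -sumrN; apply: eq_bigr => i _.
rewrite [in RHS]big_mkcond big_ord_recl /= add0r -big_mkcond -sumrN /=.
apply: eq_big => j; rewrite /bump /= !add1n ?ltnS // => _.
rewrite addSn addnS !exprS !mulN1r opprK -scalerN; congr (_ *: _).
by rewrite [RHS](fa [::]).
Qed.

End OmitFormula.

(** * Translation of the complex into functions on lists *)

Section Realization.
Variables (K : fieldType) (g h : lieAlgType K) (rho : lie_hom g (Der h)).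
Implicit Types (F G : complex g h) (s : seq g).

Definition cochain_in m (f : cochain g h m) : complex g h := dsum_in f.

(** The length of the list selects the component, so one function encodes all degrees; the default
    value of [nth] is never reached. *)
Definition ev F : seq g -> h := fun s => F (size s) (fun i => s`_i).

Lemma evE F k (x : 'I_k -> g) s :
  size s = k -> (forall i : 'I__, s`_i = x i) -> ev F s = F k x.
Proof.
by move=> sk; case: _ / sk x => x xE; congr (cochain_fun _ _); apply/funext.
Qed.

Lemma ev_inj : injective ev.
Proof.
move=> F G FG; apply: dsumP => k; apply/val_inj/funext => x /=.
have sx : size [seq x i | i <- enum 'I_k] = k by rewrite size_map size_enum_ord.
have xE (i : 'I_k) : [seq x i | i <- enum 'I_k]`_i = x i.
  by rewrite (nth_map i) ?size_enum_ord ?nth_ord_enum.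
by rewrite -(evE F sx xE) -(evE G sx xE) FG.
Qed.

Lemma ev_linear : linear ev. Proof. by []. Qed.

Lemma ev_mlin F : list_mlin (ev F).
Proof.
move=> t s a u v.
have ts w : size (t ++ w :: s) = (size t + (size s).+1)%N by rewrite size_cat.
have it : (size t < size t + (size s).+1)%N by rewrite addnS ltnS leq_addr.
have E w : ev F (t ++ w :: s) =
    F _ (upd (fun i : 'I_(size t + (size s).+1) => (t ++ 0 :: s)`_i) (Ordinal it) w).
  apply: evE => // i; rewrite /upd -val_eqE /= !nth_cat.
  case: ltngtP => [| |->]; rewrite ?subnn //= => lt_t.
  by rewrite -[(i - _)%N]prednK ?subn_gt0.
by rewrite !E (cochain_mlin (F _)).
Qed.

(** Polarization: the value vanishes on a repeated adjacent entry, in particular on [v + w]. *)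
Lemma ev_alt F : list_alt (ev F).
Proof.
move=> t v w s.
have diag u : ev F (t ++ u :: u :: s) = 0.
  have it : (size t < size (t ++ u :: u :: s))%N by rewrite size_cat /=; lia.
  have jt : ((size t).+1 < size (t ++ u :: u :: s))%N by rewrite size_cat /=; lia.
  apply: (cochain_alt (F _) (i := Ordinal it) (j := Ordinal jt)).
    by rewrite -val_eqE /= ltn_eqF.
  by rewrite /= !nth_cat ltnn ltnNge leqnSn /= subnn subSnn.
have l1 b := ev_mlin F t (b :: s).
have l2 a : linear (fun b => ev F (t ++ a :: b :: s)).
  by have := ev_mlin F (rcons t a) s; under eq_fun do rewrite cat_rcons.
have := diag (v + w); rewrite (linfD (l1 _)) !(linfD (l2 _)) !diag add0r addr0.
by move/eqP; rewrite addr_eq0 => /eqP.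
Qed.

Lemma ev_cochain_in m (f : cochain g h m) (x : 'I_m -> g) s :
  size s = m -> (forall i : 'I__, s`_i = x i) -> ev (cochain_in f) s = f x.
Proof. by move=> sm xE; rewrite (evE _ sm xE) /cochain_in dsum_in_same. Qed.

Lemma cochain_in_degree m (f : cochain g h m) : has_degree m (ev (cochain_in f)).
Proof. by move=> s sm; rewrite /ev /cochain_in dsum_in_neq // eq_sym. Qed.

(** On a list of length [m + 1] the exponents of [cdiff_fun] are [(m + 1) + i] and
    [(m + 1) + (i + j)] in 0-based indices, so [sgn] is exactly the missing sign. *)
Lemma ev_diff F : ev (complex_diff rho F) = sgn (ce rho (ev F)).
Proof.
apply/funext => s; rewrite /sgn (ce_explicit _ _ (@ev_alt F)).
case: s => [|v s]; first by rewrite /ce_diff !big_ord0 addr0 scaler0.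
set s1 := v :: s; rewrite /ev
  -[LHS]/(cdiff_fun rho (F (size s)) (fun i : 'I_(size s).+1 => s1`_i)).
rewrite /cdiff_fun /ce_diff scalerDr; congr (_ + _).
  rewrite scaler_sumr; apply: eq_bigr => i _; rewrite scalerA -exprD.
  congr (_ *: rho _ _); first by rewrite addnS.
  by symmetry; apply: evE => [|k]; rewrite ?size_omit ?nth_omit.
rewrite scaler_sumr; apply: eq_bigr => i _; rewrite scaler_sumr.
apply: eq_bigr => j ij; rewrite scalerA -exprD; congr (_ *: _).
  by congr (_ ^+ _); rewrite /=; lia.
symmetry; apply: evE => [|k].
  have jn := ltn_ord j; have sj : size (omit j s1) = size s by rewrite size_omit.
  rewrite /= size_omit sj ?prednK //; lia.
rewrite /omit2_args; case: k => -[|k] kn //=.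
by rewrite !nth_omit inordK // /bump; have := ltn_ord j; lia.
Qed.

(** Off length [m + n] both sides vanish; at that length the bracket is the shuffle sum up to the
    factor (-1)^(mn+1). *)
Lemma ev_br m n (f1 : cochain g h m) (f2 : cochain g h n) :
  ev (complex_br g h (cochain_in f1) (cochain_in f2)) =
  - ((-1) ^+ (m * n) *: wedge (ev (cochain_in f1)) (ev (cochain_in f2))).
Proof.
have d1 := cochain_in_degree f1; have d2 := cochain_in_degree f2.
rewrite /cochain_in complex_br_in -!/(cochain_in _); apply/funext => s.
rewrite -[RHS]/(- ((-1) ^+ (m * n) *: wedge (ev (cochain_in f1)) (ev (cochain_in f2)) s)).
have [smn|smn] := eqVneq (size s) (m + n)%N; last first.
  by rewrite (wedge_degree d1 d2 smn) cochain_in_degree // scaler0 oppr0.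
rewrite -(shuffle_sum_wedge _ smn (leq_addr n m) d1).
rewrite (@ev_cochain_in _ _ (fun i => s`_i)) //= /cbracket_fun addn1 exprS mulN1r scaleNr.
congr (- (_ *: _)); rewrite shuffles_block; apply: eq_bigr => t _.
set L := [seq _ | _ <- _].
have sL : size L = (m + n)%N by rewrite size_map size_enum_ord.
have LE (i : 'I_(m + n)) : L`_i = s`_(t i).
  by rewrite (nth_map i) ?size_enum_ord ?nth_ord_enum.
congr (_ *: lie _ _); symmetry; apply: ev_cochain_in => [|i].
- by rewrite size_takel // sL leq_addr.
- by rewrite nth_take // -LE.
- by rewrite size_drop sL addKn.
- by rewrite nth_drop -LE.
Qed.

End Realization.

(** * The grading of a direct sum by the integers *)

Section DirectSumGrading.
Variables (K : fieldType) (V : nat -> lmodType K).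
Implicit Types F : dsum V.

Lemma dsum_in0 k : dsum_in (0 : V k) = 0.
Proof.
apply: dsumP => j; have [<-|kj] := eqVneq k j; first by rewrite dsum_in_same.
by rewrite dsum_in_neq.
Qed.

Lemma dsum_sumE (I : Type) (r : seq I) (c : I -> dsum V) k :
  (\sum_(i <- r) c i) k = \sum_(i <- r) c i k.
Proof. by elim/big_rec2: _ => // i y F _ <-. Qed.

Lemma dsum_decomp F : exists N, F = \sum_(k < N) dsum_in (F k).
Proof.
have [N FN] := dsum_supp F; exists N; apply: dsumP => k; rewrite dsum_sumE.
have [Nk|kN] := leqP N k.
  rewrite FN // big1 // => j _.
  by rewrite dsum_in_neq // ltn_eqF // (leq_trans _ Nk).
rewrite (bigD1 (Ordinal kN)) // (dsum_in_same (F k)) big1 => [|j jk].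
  by symmetry; apply: addr0.
by rewrite -val_eqE in jk; rewrite dsum_in_neq.
Qed.

(** Reduces statements on homogeneous elements to single summands; negative degrees contain only
    0. *)
Lemma dsum_degreeP i F : dsum_degree i F ->
  F = 0 \/ exists k, i = k%:Z /\ exists u : V k, F = dsum_in u.
Proof.
case: i => [k|k] Fk; [right; exists k; split=> //; exists (F k)|left];
  apply: dsumP => j; last by rewrite Fk.
have [<-|kj] := eqVneq k j; first by rewrite dsum_in_same.
by rewrite dsum_in_neq // Fk // eqz_nat eq_sym.
Qed.

Lemma dsum_in_degree k (u : V k) : dsum_degree k (dsum_in u).
Proof. by move=> j; rewrite eqz_nat eq_sym => kj; exact: dsum_in_neq. Qed.

Lemma dsum_is_grading : is_grading (@dsum_degree K V).
Proof.
split=> [i k _ //|i a F G Fi Gi k ki|F|s c us cs].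
- by rewrite dsumDE dsumZE Fi // Gi // scaler0 addr0.
- have [N ->] := dsum_decomp F.
  exists [seq Posz k | k <- iota 0 N], (fun i => if i is Posz k then dsum_in (F k) else 0).
  split; last by rewrite big_map -(big_mkord xpredT (fun k => dsum_in (F k))) /index_iota subn0.
  by case=> k // ; exact: dsum_in_degree.
move=> c0 i si; apply: dsumP => k.
(* Component [k] of [c i] is 0 by degree unless [k = i], and there [c i] is the only summand that
   contributes to the vanishing sum. *)
have [ki|] := eqVneq (Posz k) i; last exact: cs.
have : (\sum_(j <- s) c j) k = 0 by rewrite c0.
rewrite dsum_sumE (bigD1_seq i) //= big1 ?addr0 // => j ji.
by apply: cs; rewrite ki eq_sym.
Qed.

End DirectSumGrading.

(** * The axioms of a differential graded Lie algebra *)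

Section Complex.
Variables (K : fieldType) (g h : lieAlgType K).
Implicit Types F G : complex g h.

Local Notation gr := (complex_degree g h).
Local Notation br := (complex_br g h).

Lemma complex_degreeP i F : gr i F ->
  F = 0 \/ exists k, i = k%:Z /\ exists f : cochain g h k, F = cochain_in f.
Proof. exact: dsum_degreeP. Qed.

Lemma cbracket_linearl m n (f2 : cochain g h n) :
  linear (fun f1 : cochain g h m => cbracket f1 f2).
Proof.
move=> a f f'; apply/val_inj/funext => x.
rewrite -[RHS]/(a *: cbracket_fun f f2 x + cbracket_fun f' f2 x) /=.
rewrite /cbracket_fun scalerA mulrC -scalerA -scalerDr; congr (_ *: _).
rewrite scaler_sumr -big_split; apply: eq_bigr => s _ /=.
by rewrite scalerA mulrC -scalerA -scalerDr lie_linearl.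
Qed.

Lemma cbracket_linearr m n (f1 : cochain g h m) :
  linear (fun f2 : cochain g h n => cbracket f1 f2).
Proof.
move=> a f f'; apply/val_inj/funext => x.
rewrite -[RHS]/(a *: cbracket_fun f1 f x + cbracket_fun f1 f' x) /=.
rewrite /cbracket_fun scalerA mulrC -scalerA -scalerDr; congr (_ *: _).
rewrite scaler_sumr -big_split; apply: eq_bigr => s _ /=.
by rewrite scalerA mulrC -scalerA -scalerDr lie_linearr.
Qed.

Lemma ecast_cochain_linear m n (e : m = n) :
  linear (fun f : cochain g h m => ecast i (cochain g h i) e f).
Proof. by case: _ / e. Qed.

Lemma complex_br_linearl G : linear (br^~ G).
Proof.
move=> a F F'; apply: dsumP => k.
rewrite -[RHS]/(a *: complex_br_fun F G k + complex_br_fun F' G k).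
rewrite -[LHS]/(complex_br_fun (a *: F + F') G k) /complex_br_fun.
rewrite scaler_sumr -big_split; apply: eq_bigr => m _ /=.
by rewrite -ecast_cochain_linear -cbracket_linearl.
Qed.

Lemma complex_br_linearr F : linear (br F).
Proof.
move=> a G G'; apply: dsumP => k.
rewrite -[RHS]/(a *: complex_br_fun F G k + complex_br_fun F G' k).
rewrite -[LHS]/(complex_br_fun F (a *: G + G') k) /complex_br_fun.
rewrite scaler_sumr -big_split; apply: eq_bigr => m _ /=.
by rewrite -ecast_cochain_linear -cbracket_linearr.
Qed.

Lemma complex_br_degree i j F G : gr i F -> gr j G -> gr (i + j) (br F G).
Proof.
move=> /complex_degreeP[->|[m [-> [f ->]]]].
  by move=> _; rewrite (linf0 (complex_br_linearl _)).
move=> /complex_degreeP[->|[n [-> [f' ->]]]].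
  by rewrite (linf0 (complex_br_linearr _)).
by rewrite -PoszD /cochain_in complex_br_in; exact: dsum_in_degree.
Qed.

Lemma complex_br_antisym i j F G : gr i F -> gr j G ->
  br F G = - ((-1) ^ (i * j) *: br G F).
Proof.
move=> /complex_degreeP[->|[m [-> [f ->]]]].
  move=> _; rewrite (linf0 (complex_br_linearl _)).
  by rewrite (linf0 (complex_br_linearr _)) scaler0 oppr0.
move=> /complex_degreeP[->|[n [-> [f' ->]]]].
  by rewrite (linf0 (complex_br_linearl _)) (linf0 (complex_br_linearr _)) scaler0 oppr0.
apply: ev_inj; rewrite (linfN (@ev_linear K g h)) (linfZ (@ev_linear K g h)) !ev_br.
have [df df'] := (cochain_in_degree f, cochain_in_degree f').
rewrite -PoszM (mulnC n) (wedgeC (degree_parity df) (degree_parity df')).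
by rewrite -oddM signr_odd.
Qed.

(** Every double bracket acquires the same normalizing sign (-1)^(mn+mp+np), so the claim is
    [wedge_jacobi]. *)
Lemma complex_br_jacobi i j k F G H : gr i F -> gr j G -> gr k H ->
  br F (br G H) = br (br F G) H + (-1) ^ (i * j) *: br G (br F H).
Proof.
have z1 (A : complex g h) : br 0 A = 0 by exact: linf0 (complex_br_linearl A).
have z2 (A : complex g h) : br A 0 = 0 by exact: linf0 (complex_br_linearr A).
move=> /complex_degreeP[->|[m [-> [f ->]]]].
  by rewrite !z1 z2 scaler0 addr0.
move=> /complex_degreeP[->|[n [-> [f' ->]]]].
  by rewrite !z1 !z2 z1 scaler0 addr0.
move=> /complex_degreeP[->|[p [_ [f'' ->]]]].
  by rewrite !z2 scaler0 addr0.
have [df df'] := (cochain_in_degree f, cochain_in_degree f').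
have E a b (u : cochain g h a) (v : cochain g h b) :
    ev (cochain_in (cbracket u v)) =
    - ((-1) ^+ (a * b) *: wedge (ev (cochain_in u)) (ev (cochain_in v))).
  by rewrite -ev_br /cochain_in complex_br_in.
apply: ev_inj; rewrite (linfD (@ev_linear K g h)) (linfZ (@ev_linear K g h)).
rewrite {2 4 6}/cochain_in !complex_br_in -!/(cochain_in _) !E.
rewrite (linfN (wedge_linearl _)) !(linfN (wedge_linearr _)) !scalerN !opprK.
rewrite (linfZ (wedge_linearl _)) !(linfZ (wedge_linearr _)) -PoszM -exprnP.
rewrite (wedge_jacobi _ (degree_parity df) (degree_parity df')).
rewrite -oddM signr_odd !scalerDr !scalerA -!exprD.
by congr (_ ^+ _ *: _ + _ ^+ _ *: _); lia.
Qed.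

Variable rho : lie_hom g (Der h).

Local Notation d := (complex_diff rho).

Lemma complex_diff_linear : linear d.
Proof.
move=> a F G; apply: ev_inj; rewrite (@ev_linear K g h) !ev_diff.
by rewrite (@ev_linear K g h) ce_linear sgn_linear.
Qed.

Lemma complex_diff_degree i F : gr i F -> gr (i + 1) (d F).
Proof.
move=> /complex_degreeP[->|[m [-> [f ->]]]]; first by rewrite (linf0 complex_diff_linear).
by rewrite -PoszD addn1 /cochain_in complex_diff_in; exact: dsum_in_degree.
Qed.

(** On lists the differential is [sgn] after [ce], and these anticommute, so its square is minus
    that of [ce]. *)
Lemma complex_diff_diff F : d (d F) = 0.
Proof.
apply: ev_inj; rewrite !ev_diff -[ce _ (sgn _)]opprK -sgn_ce (linfN (@sgn_linear _ _ _)).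
by rewrite sgnK (ce_ce _ (@ev_mlin _ _ _ F)) oppr0.
Qed.

(** This is [ce_wedge], after the signs of [ev_diff] and [ev_br] have been collected. *)
Lemma complex_diff_br i F G : gr i F ->
  d (br F G) = br (d F) G + (-1) ^ i *: br F (d G).
Proof.
move=> /complex_degreeP[->|[m [-> [f ->]]]].
  rewrite (linf0 complex_diff_linear) !(linf0 (complex_br_linearl _)).
  by rewrite (linf0 complex_diff_linear) scaler0 addr0.
(* [ev_br] concerns single cochains, so [G] is split into components, in which both sides are
   additive. *)
have [N ->] := dsum_decomp G.
elim/big_rec: _ => [|n G' _ IH].
  rewrite !(linf0 complex_diff_linear) !(linf0 (complex_br_linearr _)).
  by rewrite (linf0 complex_diff_linear) scaler0 addr0.
rewrite !(linfD complex_diff_linear, linfD (complex_br_linearr _)) IH.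
rewrite scalerDr [RHS]addrACA; congr (_ + _); move: (G n) => f' {IH G'}.
apply: ev_inj; rewrite (linfD (@ev_linear K g h)) (linfZ (@ev_linear K g h)).
rewrite -/(cochain_in f') ev_diff ev_br.
have dE a (u : cochain g h a) : d (cochain_in u) = cochain_in (cdiff rho u).
  exact: complex_diff_in.
have evdE a (u : cochain g h a) :
    ev (cochain_in (cdiff rho u)) = sgn (ce rho (ev (cochain_in u))).
  by rewrite -dE ev_diff.
rewrite !dE !ev_br !evdE.
have [df df'] := (cochain_in_degree f, cochain_in_degree f').
rewrite !sgn_ce (linfN (@sgn_linear _ _ _)) (linfZ (@sgn_linear _ _ _)) sgn_wedge.
rewrite (sgn_degree df) (sgn_degree df') !(linfN (ce_linear _), linfZ (ce_linear _)).
rewrite !(linfN (wedge_linearl _), linfZ (wedge_linearl _)).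
rewrite !(linfN (wedge_linearr _), linfZ (wedge_linearr _)).
rewrite !(linfZ (ce_linear _)) ce_wedge (sgn_degree df) (linfZ (wedge_linearl _)).
rewrite !scalerN !opprK -exprnP !scalerDr !scalerA -!exprD.
by congr (_ ^+ _ *: _ + _ ^+ _ *: _); lia.
Qed.

Lemma complex_is_dgla : is_dgla gr br d.
Proof.
split.
- exact: dsum_is_grading.
- exact: complex_br_linearl.
- exact: complex_br_linearr.
- exact: complex_br_degree.
- exact: complex_br_antisym.
- exact: complex_br_jacobi.
- exact: complex_diff_linear.
- exact: complex_diff_degree.
- exact: complex_diff_diff.
- exact: complex_diff_br.
Qed.

End Complex.

(** * Maurer-Cartan elements and crossed homomorphisms *)

Section MaurerCartan.
Variables (K : fieldType) (g h : lieAlgType K) (rho : lie_hom g (Der h)).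
Hypothesis two_neq0 : 2 != 0 :> K.

(** The curvature is of degree 2, hence determined by its values on pairs, where it is the defect of
    the crossed homomorphism equation. *)
Lemma curvature_cochain1 (H : {linear g -> h}) :
  let theta := cochain_in (cochain1 H) in
  complex_diff rho theta + 2^-1 *: complex_br g h theta theta = 0 <->
  crossed_hom rho H.
Proof.
set theta := cochain_in _; rewrite /=.
have evH x : ev theta [:: x] = H x by rewrite (@ev_cochain_in _ _ _ _ _ (fun=> x)) // => i; rewrite ord1.
have theta_deg := cochain_in_degree (cochain1 H).
have evE : ev (complex_diff rho theta + 2^-1 *: complex_br g h theta theta) =
    sgn (ce rho (ev theta)) + 2^-1 *: wedge (ev theta) (ev theta).
  rewrite (linfD (@ev_linear K g h)) (linfZ (@ev_linear K g h)) ev_diff ev_br.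
  by rewrite muln1 expr1 scaleN1r opprK.
have deg2 : has_degree 2 (ev (complex_diff rho theta + 2^-1 *: complex_br g h theta theta)).
  rewrite /theta /cochain_in complex_diff_in complex_br_in -!/(cochain_in _).
  rewrite (linfD (@ev_linear K g h)) (linfZ (@ev_linear K g h)) => s s2.
  rewrite -[LHS]/(ev (cochain_in _) s + 2^-1 *: ev (cochain_in _) s).
  by rewrite (cochain_in_degree _ s2) (cochain_in_degree _ s2) scaler0 addr0.
have val2 x y : ev (complex_diff rho theta + 2^-1 *: complex_br g h theta theta) [:: x; y] =
    rho x (H y) - rho y (H x) + lie (H x) (H y) - H (lie x y).
  rewrite evE -[LHS]/(sgn _ [:: x; y] + 2^-1 *: wedge _ _ [:: x; y]).
  rewrite {1}/sgn /= expr2 mulrNN mulr1 scale1r /sgn /contr /= !evH.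
  rewrite !theta_deg //= !lie0r !lier0.
  rewrite subr0 add0r addr0 expr0 expr1 scale1r scaleN1r.
  (* The product of [theta] with itself is [Hx, Hy] - [Hy, Hx], twice [Hx, Hy]; the factor [2^-1]
     removes the 2. *)
  rewrite (linfN (lie_linearl _)) -lieC -mulr2n -scaler_nat scalerA mulVf // scale1r.
  by rewrite [LHS](AC (2*1*1) ((1*3)*4*2)).
split=> [E x y|H_crossed].
  by apply/eqP; rewrite eq_sym -subr_eq0 -val2 E.
apply: ev_inj; apply/funext => s.
have [|s2] := eqVneq (size s) 2; last by rewrite deg2.
by case: s => [|x [|y []]] // _; rewrite val2 H_crossed subrr.
Qed.

Lemma complex_maurer_cartan (theta : complex g h) :
  maurer_cartan (complex_degree g h) (complex_br g h) (complex_diff rho) theta <->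
  exists2 H : {linear g -> h}, crossed_hom rho H & theta = dsum_in (cochain1 H).
Proof.
split=> [[theta1 MC]|[H H_crossed ->]]; last first.
  by split; [exact: dsum_in_degree | exact/curvature_cochain1].
have [theta0|[_ [[<-] [f thetaE]]]] := complex_degreeP theta1.
  (* The zero element corresponds to the zero map, which is a crossed homomorphism. *)
  exists (\0 : {linear g -> h}) => [x y|];
    first by rewrite /= !(linf0 (rho_linr _ _)) lie0r subrr addr0.
  rewrite theta0 (_ : cochain1 _ = 0) ?dsum_in0 //.
  by apply/val_inj.
have [H fE] := cochain1_surj f; rewrite fE in thetaE; exists H => //.
by apply/curvature_cochain1; rewrite -thetaE.
Qed.

End MaurerCartan.

Theorem proposition5p4 (K : closedFieldType) (K_char0 : [pchar K] =i pred0)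
    (g h : lieAlgType K) (rho : lie_hom g (Der h)) :
  is_dgla (complex_degree g h) (complex_br g h) (complex_diff rho) /\
  (forall theta : complex g h,
     maurer_cartan (complex_degree g h) (complex_br g h)
       (complex_diff rho) theta <->
     exists2 H : {linear g -> h},
       crossed_hom rho H & theta = dsum_in (cochain1 H)).
Proof.
split; first exact: complex_is_dgla.
apply: complex_maurer_cartan.
(* As 2 is prime, not being a characteristic of [K] means being nonzero in [K]. *)
by have := K_char0 2; rewrite !inE => /negbT.
Qed.
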